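(* Let $f:\mathbb{R}^n\to\mathbb{R}$ be continuous and semi-algebraic, and fix $\bar x\in\mathbb{R}^n$. Then there is $\bar\epsilon>0$ such that for every $\epsilon\in(0,\bar\epsilon]$ the robust regularization $\bar f_\epsilon$ is Lipschitz at $\bar x$ and $\operatorname{calm}\bar f_\epsilon(\bar x)=\operatorname{lip}\bar f_\epsilon(\bar x)<\infty$; moreover $\epsilon\cdot\operatorname{lip}\bar f_\epsilon(\bar x)\to0$ as $\epsilon\downarrow0$ (i.e. the moduli are $o(1/\epsilon)$).
   Context: A function is semi-algebraic if its graph is a finite union of sets each defined by finitely many polynomial equalities and inequalities. $\bar f_\epsilon(x):=\max\{f(x'):|x'-x|\le\epsilon\}$. $\operatorname{calm}F(\bar x):=\limsup_{x\to\bar x,\,x\ne\bar x}\frac{|F(x)-F(\bar x)|}{|x-\bar x|}$, $\operatorname{lip}F(\bar x):=\limsup_{x,x'\to\bar x,\,x\ne x'}\frac{|F(x)-F(x')|}{|x-x'|}$; $F$ is Lipschitz at $\bar x$ if $\operatorname{lip}F(\bar x)<\infty$. *)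

(* Defs.v *)
From Stdlib Require Import Reals Lra List ClassicalEpsilon.
Open Scope R_scope.

Definition vec (n : nat) := { x : nat -> R | forall i, (n <= i)%nat -> x i = 0 }.

Definition vc {n} (x : vec n) : nat -> R := proj1_sig x.

Fixpoint sumR (k : nat) (g : nat -> R) : R :=
  match k with O => 0 | S k' => sumR k' g + g k' end.

Definition dist {n} (x y : vec n) : R :=
  sqrt (sumR n (fun i => (vc x i - vc y i) ^ 2)).

Inductive poly : Type :=
| PConst : R -> poly
| PVar : nat -> poly
| PAdd : poly -> poly -> poly
| PMul : poly -> poly -> poly
| POpp : poly -> poly.

Fixpoint peval (p : poly) (z : nat -> R) : R :=
  match p with
  | PConst c => c
  | PVar i => z i
  | PAdd p q => peval p z + peval q z
  | PMul p q => peval p z * peval q z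
  | POpp p => - peval p z
  end.

Definition basic_sa (B : list poly * list poly) (z : nat -> R) : Prop :=
  (forall p, In p (fst B) -> peval p z = 0) /\
  (forall q, In q (snd B) -> peval q z > 0).

Definition semialgebraic_set (S : (nat -> R) -> Prop) : Prop :=
  exists L : list (list poly * list poly),
    forall z, S z <-> exists B, In B L /\ basic_sa B z.

Definition pt {n} (x : vec n) (t : R) : nat -> R :=
  fun i => if Nat.ltb i n then vc x i else if Nat.eqb i n then t else 0.

(** f : R^n -> R is semi-algebraic: its graph in R^(n+1) is semi-algebraic.
    (Only points of R^(n+1) are considered: polynomial variables of index > n
    are evaluated at 0.) *)
Definition semialgebraic_fun {n} (f : vec n -> R) : Prop :=
  exists L : list (list poly * list poly),
    forall (x : vec n) (t : R),
      t = f x <-> exists B, In B L /\ basic_sa B (pt x t).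

Definition continuous_vec {n} (f : vec n -> R) : Prop :=
  forall x eps, eps > 0 -> exists d, d > 0 /\
    forall y, dist y x < d -> Rabs (f y - f x) < eps.

Definition supR (E : R -> Prop) : R :=
  epsilon (inhabits 0) (fun s => is_lub E s).

Definition robust_reg {n} (f : vec n -> R) (eps : R) (x : vec n) : R :=
  supR (fun v => exists x', dist x' x <= eps /\ v = f x').

(** calm F xb = L (finite):  L = limsup_{x -> xb, x <> xb} |F x - F xb|/|x - xb|. *)
Definition calm_is {n} (F : vec n -> R) (xb : vec n) (L : R) : Prop :=
  (forall e, e > 0 -> exists d, d > 0 /\
     forall x, 0 < dist x xb < d ->
       Rabs (F x - F xb) / dist x xb < L + e) /\
  (forall e d, e > 0 -> d > 0 -> exists x, 0 < dist x xb < d /\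
       Rabs (F x - F xb) / dist x xb > L - e).

(** lip F xb = L (finite):
    L = limsup_{x, x' -> xb, x <> x'} |F x - F x'|/|x - x'|. *)
Definition lip_is {n} (F : vec n -> R) (xb : vec n) (L : R) : Prop :=
  (forall e, e > 0 -> exists d, d > 0 /\
     forall x x', dist x xb < d -> dist x' xb < d -> dist x x' > 0 ->
       Rabs (F x - F x') / dist x x' < L + e) /\
  (forall e d, e > 0 -> d > 0 -> exists x x',
       dist x xb < d /\ dist x' xb < d /\ dist x x' > 0 /\
       Rabs (F x - F x') / dist x x' > L - e).

(* Main.v *)
(** Write [G r x] for the robust regularization and [g r = G r xb].  The basic
    inequality is [G r x <= G r' x'] whenever [r + |x - x'| <= r'], so the slopes
    of [G r] at [x] are controlled by the slopes of [G] in [r].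

    By Tarski-Seidenberg every one-variable predicate definable from [f] is
    eventually true or eventually false to the right of each point.  Combined
    with Baire, a covering of an interval by countably many definable sets has
    a member containing an interval, which replaces the monotonicity theorem.
    Since [g] is monotone and [g r -> f xb] as [r -> 0], a definable failure of
    calmness, or of [calm = o(1/r)], would hold for all small [r] and make [g]
    grow too fast.

    Suppose [calm < q1 < q2 < lip] on an interval of radii.  Then there are
    points [x] arbitrarily close to [xb] at which [G] has slope at least [q2]
    in [r].  Choose them definably as [x r s] with [|x r s - xb| <= s]; on a
    smaller interval [x] is Lipschitz in [r], with an arbitrarily small constant
    once [s] is small.  By the basic inequality [G r (x r s)] then has slope
    close to [q2] in [r], whereas as [s -> 0] it converges to [g], whose slope
    is at most [q1]. *)
From Stdlib Require Import Reals Lra Lia List Arith ZArith Classical ClassicalEpsilon.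
From Stdlib Require Import FunctionalExtensionality PropExtensionality ProofIrrelevance.
Require Import Defs.
From mathcomp Require all_boot all_order all_algebra Rstruct ordered_qelim qe_rcf.
Set Bullet Behavior "Strict Subproofs".
Open Scope R_scope.

(** * Quantifier elimination *)

(** The delicate point is uniformity in [s]. The final contradiction compares an error
    [q1 * (2 * s)] with [(q2 - q1) / 2] times the length of the interval of radii, so this interval
    must be fixed before [s] tends to 0; a dichotomy on an interval depending on [s] would be
    useless.

    The Lipschitz constant of the selection can be made small because every [x r s] stays within [s]
    of [xb]: a coordinate whose slope exceeded [th] throughout a fixed interval would travel farther
    than [2 * s]. It has to be small because a centre that moves by [th * t] while the radius grows
    by [t] uses up that part of the growth, so only the slope [q2 * (1 - th)] survives, and this
    must still exceed [q1].

    Formulas are quantifier-free from the start. Quantifier elimination enters only as closure of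
    definability under quantifiers, and one-variable tameness then reduces to the sign of a
    polynomial just to the right of a point. *)

Inductive qform : Type :=
| QZero : Defs.poly -> qform
| QPos : Defs.poly -> qform
| QNot : qform -> qform
| QAnd : qform -> qform -> qform.

Fixpoint qeval (f : qform) (e : nat -> R) : Prop :=
  match f with
  | QZero p => peval p e = 0
  | QPos p => 0 < peval p e
  | QNot f => ~ qeval f e
  | QAnd f g => qeval f e /\ qeval g e
  end.

Definition scons (x : R) (e : nat -> R) : nat -> R :=
  fun i => match i with O => x | S j => e j end.

Definition shift (e : nat -> R) : nat -> R := fun i => e (S i).

Module QElim.
Import all_boot all_order all_algebra Rstruct ordered_qelim qe_rcf.
Import Order.TTheory GRing.Theory Num.Theory.
Local Open Scope ring_scope.

(** The default case is inversion, which [GRing.rterm] excludes. *)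
Fixpoint poly_of_term (t : GRing.term R) : Defs.poly :=
  match t with
  | GRing.Var i => PVar i
  | GRing.Const c => PConst c
  | GRing.NatConst n => PConst n%:R
  | GRing.Add u v => PAdd (poly_of_term u) (poly_of_term v)
  | GRing.Opp u => POpp (poly_of_term u)
  | GRing.NatMul u n => PMul (PConst n%:R) (poly_of_term u)
  | GRing.Mul u v => PMul (poly_of_term u) (poly_of_term v)
  | GRing.Exp u n => iter n (PMul (poly_of_term u)) (PConst 1)
  | _ => PConst 0
  end.

Lemma peval_poly_of_term (t : GRing.term R) (e : seq R) :
  GRing.rterm t -> peval (poly_of_term t) (fun i => e`_i) = GRing.eval e t.
Proof.
elim: t => //=.
- by move=> u IHu v IHv /andP[/IHu-> /IHv->].
- by move=> u IHu /IHu->.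
- by move=> u IHu n /IHu->; rewrite RmultE mulr_natl.
- by move=> u IHu v IHv /andP[/IHu-> /IHv->].
- move=> u IHu n /IHu {}IHu; elim: n => [|n IHn] //=.
  by rewrite IHn IHu exprS.
Qed.

Fixpoint term_of_poly (p : Defs.poly) : GRing.term R :=
  match p with
  | PConst c => GRing.Const c
  | PVar i => GRing.Var _ i
  | PAdd p q => GRing.Add (term_of_poly p) (term_of_poly q)
  | PMul p q => GRing.Mul (term_of_poly p) (term_of_poly q)
  | POpp p => GRing.Opp (term_of_poly p)
  end.

Lemma rterm_of_poly p : GRing.rterm (term_of_poly p).
Proof. by elim: p => //= p -> q ->. Qed.

(** Formulas on the mathcomp side are evaluated in finite sequences, those here in infinite
    environments; the two need to agree only below this bound. *)
Fixpoint pbound (p : Defs.poly) : nat :=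
  match p with
  | PConst _ => 0
  | PVar i => i.+1
  | PAdd p q | PMul p q => maxn (pbound p) (pbound q)
  | POpp p => pbound p
  end.

Lemma eval_term_of_poly (p : Defs.poly) (s : seq R) (e : nat -> R) :
  (forall i, (i < pbound p)%N -> s`_i = e i) ->
  GRing.eval s (term_of_poly p) = peval p e.
Proof.
elim: p => //= [i|p IHp q IHq|p IHp q IHq|p IHp] h.
- exact: h.
- by rewrite IHp ?IHq // => i hi; apply: h; rewrite leq_max hi ?orbT.
- by rewrite IHp ?IHq // => i hi; apply: h; rewrite leq_max hi ?orbT.
- by rewrite IHp.
Qed.

Fixpoint formula_of_qform (f : qform) : ord.formula R :=
  match f with
  | QZero p => ord.Equal (term_of_poly p) (GRing.Const 0)
  | QPos p => ord.Lt (GRing.Const 0) (term_of_poly p)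
  | QNot f => ord.Not (formula_of_qform f)
  | QAnd f g => ord.And (formula_of_qform f) (formula_of_qform g)
  end.

Lemma rformula_of_qform f : ord.rformula (formula_of_qform f).
Proof. by elim: f => //= [p|p|f -> g ->] //; rewrite rterm_of_poly. Qed.

Fixpoint qbound (f : qform) : nat :=
  match f with
  | QZero p | QPos p => pbound p
  | QNot f => qbound f
  | QAnd f g => maxn (qbound f) (qbound g)
  end.

Lemma holds_formula_of_qform (f : qform) (s : seq R) (e : nat -> R) :
  (forall i, (i < qbound f)%N -> s`_i = e i) ->
  ord.holds s (formula_of_qform f) <-> qeval f e.
Proof.
elim: f => /= [p h|p h|f IHf h|f IHf g IHg h].
- by rewrite (eval_term_of_poly _ _ _ h).
- by rewrite (eval_term_of_poly _ _ _ h); split=> /RltP.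
- by rewrite IHf.
- by rewrite IHf ?IHg // => i hi; apply: h; rewrite leq_max hi ?orbT.
Qed.

(** The default case covers unit tests, excluded by [ord.rformula], and quantifiers, excluded by
    [ord.qf_form]. *)
Fixpoint qform_of_formula (f : ord.formula R) : qform :=
  match f with
  | ord.Bool b => QZero (PConst (if b then 0 else 1))
  | ord.Equal u v => QZero (PAdd (poly_of_term u) (POpp (poly_of_term v)))
  | ord.Lt u v => QPos (PAdd (poly_of_term v) (POpp (poly_of_term u)))
  | ord.Le u v => QNot (QPos (PAdd (poly_of_term u) (POpp (poly_of_term v))))
  | ord.And f g => QAnd (qform_of_formula f) (qform_of_formula g)
  | ord.Or f g => QNot (QAnd (QNot (qform_of_formula f)) (QNot (qform_of_formula g)))
  | ord.Implies f g => QNot (QAnd (qform_of_formula f) (QNot (qform_of_formula g)))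
  | ord.Not f => QNot (qform_of_formula f)
  | _ => QZero (PConst 0)
  end.

Lemma qeval_qform_of_formula (f : ord.formula R) (s : seq R) :
  ord.qf_form f -> ord.rformula f ->
  qeval (qform_of_formula f) (fun i => s`_i) <-> ord.qf_eval s f.
Proof.
elim: f => //=.
- by case=> _ _; split=> // /eqP; rewrite oner_eq0.
- move=> u v _ /andP[ru rv]; rewrite !peval_poly_of_term // RplusE RoppE.
  by split=> [h|/eqP ->]; [rewrite -subr_eq0; apply/eqP | rewrite subrr].
- move=> u v _ /andP[ru rv]; rewrite !peval_poly_of_term // RplusE RoppE.
  by rewrite -subr_gt0; split=> /RltP.
- move=> u v _ /andP[ru rv]; rewrite !peval_poly_of_term // RplusE RoppE.
  rewrite leNgt; split=> [h|/negP h h']; first (apply/negP => h';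
    by apply: h; apply/RltP; rewrite subr_gt0).
  by apply: h; move/RltP: h'; rewrite subr_gt0.
- move=> f IHf g IHg /andP[qf qg] /andP[rf rg]; rewrite IHf // IHg //.
  by split=> [[-> ->]|/andP[]].
- move=> f IHf g IHg /andP[qf qg] /andP[rf rg]; rewrite IHf // IHg //.
  by split=> [h|/orP h]; [apply/orP; apply: NNPP; tauto | tauto].
- move=> f IHf g IHg /andP[qf qg] /andP[rf rg]; rewrite IHf // IHg //.
  by split=> [h|/implyP h]; [apply/implyP => ?; apply: NNPP; tauto | tauto].
- by move=> f IHf qf rf; rewrite IHf //; split=> /negP.
Qed.

Fixpoint psubst (s : nat -> Defs.poly) (p : Defs.poly) : Defs.poly :=
  match p with
  | PConst c => PConst c
  | PVar i => s i
  | PAdd p q => PAdd (psubst s p) (psubst s q)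
  | PMul p q => PMul (psubst s p) (psubst s q)
  | POpp p => POpp (psubst s p)
  end.

Lemma peval_psubst s p e :
  peval (psubst s p) e = peval p (fun i => peval (s i) e).
Proof. by elim: p => //= [p -> q ->|p -> q ->|p ->]. Qed.

Fixpoint qsubst (s : nat -> Defs.poly) (f : qform) : qform :=
  match f with
  | QZero p => QZero (psubst s p)
  | QPos p => QPos (psubst s p)
  | QNot f => QNot (qsubst s f)
  | QAnd f g => QAnd (qsubst s f) (qsubst s g)
  end.

Lemma qeval_qsubst s f e :
  qeval (qsubst s f) e <-> qeval f (fun i => peval (s i) e).
Proof. by elim: f => /= [p|p|f IHf|f IHf g IHg]; rewrite ?peval_psubst ?IHf ?IHg. Qed.

Lemma qform_exists (f : qform) :
  exists g : qform, forall e, qeval g e <-> exists x, qeval f (scons x e).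
Proof.
set N := qbound f.
set F := ord.Exists 0 (formula_of_qform f).
have rF : ord.rformula F by rewrite /= rformula_of_qform.
have QE s := ord.quantifier_elim_rformP (@wf_QE_wproj R) (@valid_QE_wproj R) s rF.
have /andP[qG rG] := ord.quantifier_elim_wf (@wf_QE_wproj R) rF.
set G := ord.quantifier_elim _ F in QE qG rG.
(* The eliminated formula may still mention index 0 or indices beyond [N]. Both are read as 0,
   exactly as in the list [l] below, and the other indices move down by one. *)
pose s i := if i is j.+1 then (if (j < N)%N then PVar j else PConst 0) else PConst 0.
exists (qsubst s (qform_of_formula G)) => e.
pose l : seq R := 0 :: mkseq e N.
have -> : qeval (qsubst s (qform_of_formula G)) e <-> qeval (qform_of_formula G) (fun i => l`_i).
  rewrite qeval_qsubst; suff -> : (fun i => peval (s i) e) = (fun i => l`_i) by [].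
  apply: functional_extensionality => -[|j] //=.
  case: ltnP => jN; first by rewrite nth_mkseq.
  by rewrite nth_default // size_mkseq.
rewrite qeval_qform_of_formula //.
have -> : ord.qf_eval l G <-> ord.holds l F by split=> /QE.
have H x : ord.holds (x :: mkseq e N) (formula_of_qform f) <-> qeval f (scons x e).
  apply: holds_formula_of_qform => -[|i] //= hi.
  by rewrite nth_mkseq // ltnW.
by split=> -[x hx]; exists x; apply/H.
Qed.
End QElim.

(** * Definable predicates and functions *)

(* Environments are de Bruijn: a quantifier binds index 0 and shifts the others. *)
Definition sa (P : (nat -> R) -> Prop) : Prop :=
  exists f, forall e, P e <-> qeval f e.

(** Definability of the graph: index 0 holds the value, so [a] reads the shifted environment. *)
Definition df (a : (nat -> R) -> R) : Prop :=
  sa (fun e => e O = a (shift e)).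

Lemma sa_ext (P Q : (nat -> R) -> Prop) :
  (forall e, P e <-> Q e) -> sa P -> sa Q.
Proof.
  intros H [f Hf]. exists f. intros e. rewrite <- H. apply Hf.
Qed.

Lemma sa_subst (s : nat -> Defs.poly) P :
  sa P -> sa (fun e => P (fun i => peval (s i) e)).
Proof.
  intros [f Hf]. exists (QElim.qsubst s f). intros e.
  rewrite QElim.qeval_qsubst. apply Hf.
Qed.

Lemma sa_rename (r : nat -> nat) P : sa P -> sa (fun e => P (fun i => e (r i))).
Proof. exact (sa_subst (fun i => PVar (r i)) P). Qed.

Lemma sa_zero p : sa (fun e => peval p e = 0).
Proof. exists (QZero p). intros e. simpl. tauto. Qed.

Lemma sa_pos p : sa (fun e => 0 < peval p e).
Proof. exists (QPos p). intros e. simpl. tauto. Qed.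

Lemma sa_not P : sa P -> sa (fun e => ~ P e).
Proof. intros [f Hf]. exists (QNot f). intros e. simpl. rewrite Hf. tauto. Qed.

Lemma sa_and P Q : sa P -> sa Q -> sa (fun e => P e /\ Q e).
Proof.
  intros [f Hf] [g Hg]. exists (QAnd f g). intros e. simpl. rewrite Hf, Hg. tauto.
Qed.

Lemma sa_or P Q : sa P -> sa Q -> sa (fun e => P e \/ Q e).
Proof.
  intros HP HQ. apply sa_ext with (fun e => ~ (~ P e /\ ~ Q e)).
  - intros e. tauto.
  - auto using sa_not, sa_and.
Qed.

Lemma sa_imp P Q : sa P -> sa Q -> sa (fun e => P e -> Q e).
Proof.
  intros HP HQ. apply sa_ext with (fun e => ~ (P e /\ ~ Q e)).
  - intros e. tauto.
  - auto using sa_not, sa_and.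
Qed.

Lemma sa_const (P : Prop) : sa (fun _ => P).
Proof.
  destruct (classic P) as [H|H].
  - apply sa_ext with (fun e => peval (PConst 0) e = 0); [|apply sa_zero].
    simpl. tauto.
  - apply sa_ext with (fun e => 0 < peval (PConst 0) e); [|apply sa_pos].
    simpl. intros e. split; intros; [lra|tauto].
Qed.

Lemma sa_ex (Q : (nat -> R) -> R -> Prop) :
  sa (fun e => Q (shift e) (e O)) -> sa (fun e => exists x, Q e x).
Proof.
  intros [f Hf]. destruct (QElim.qform_exists f) as [g Hg].
  exists g. intros e. rewrite Hg.
  split; intros [x Hx]; exists x; apply (Hf (scons x e)); exact Hx.
Qed.

Lemma sa_all (Q : (nat -> R) -> R -> Prop) :
  sa (fun e => Q (shift e) (e O)) -> sa (fun e => forall x, Q e x).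
Proof.
  intros H. apply sa_ext with (fun e => ~ exists x, ~ Q e x).
  - intros e. split.
    + intros Hn x. apply NNPP. intros Hx. apply Hn. now exists x.
    + intros Ha [x Hx]. auto.
  - apply sa_not, sa_ex, sa_not, H.
Qed.

Lemma sa_forall_lt k (P : nat -> (nat -> R) -> Prop) :
  (forall i, (i < k)%nat -> sa (P i)) ->
  sa (fun e => forall i, (i < k)%nat -> P i e).
Proof.
  induction k as [|k IH]; intros H.
  - apply sa_ext with (fun _ => True); [|apply sa_const].
    intros e. split; auto. intros _ i Hi. lia.
  - apply sa_ext with (fun e => (forall i, (i < k)%nat -> P i e) /\ P k e).
    + intros e. split.
      * intros [H1 H2] i Hi. destruct (Nat.eq_dec i k) as [->|]; auto.
        apply H1. lia.
      * intros H1. split; auto.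
    + apply sa_and; auto.
Qed.

Lemma sa_exists_in {A} (L : list A) (P : A -> (nat -> R) -> Prop) :
  (forall a, sa (P a)) -> sa (fun e => exists a, In a L /\ P a e).
Proof.
  intros H. induction L as [|a L IH].
  - apply sa_ext with (fun _ => False); [|apply sa_const].
    intros e. split; [tauto|]. intros [b [[] _]].
  - apply sa_ext with (fun e => P a e \/ exists b, In b L /\ P b e).
    + intros e. split.
      * intros [H1|[b [H1 H2]]]; [exists a|exists b]; simpl; auto.
      * intros [b [[->|H1] H2]]; [auto|right; exists b; auto].
    + apply sa_or; auto.
Qed.

Lemma sa_forall_in {A} (L : list A) (P : A -> (nat -> R) -> Prop) :
  (forall a, sa (P a)) -> sa (fun e => forall a, In a L -> P a e).
Proof.
  intros H. induction L as [|a L IH].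
  - apply sa_ext with (fun _ => True); [|apply sa_const]. simpl. tauto.
  - apply sa_ext with (fun e => P a e /\ forall b, In b L -> P b e).
    + intros e. simpl. split.
      * intros [H1 H2] b [<-|Hb]; auto.
      * intros H1. split; auto.
    + apply sa_and; auto.
Qed.

Lemma df_var k : df (fun e => e k).
Proof.
  apply sa_ext with (fun e => peval (PAdd (PVar 0) (POpp (PVar (S k)))) e = 0);
    [|apply sa_zero].
  intros e. unfold shift. simpl. lra.
Qed.

Lemma df_const c : df (fun _ => c).
Proof.
  apply sa_ext with (fun e => peval (PAdd (PVar 0) (POpp (PConst c))) e = 0);
    [|apply sa_zero].
  intros e. simpl. lra.
Qed.

Lemma df_rename (r : nat -> nat) a : df a -> df (fun e => a (fun i => e (r i))).
Proof.
  intros H.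
  exact (sa_rename (fun i => match i with O => O | S j => S (r j) end) _ H).
Qed.

Lemma df_shift a : df a -> df (fun e => a (shift e)).
Proof. exact (df_rename S a). Qed.

Lemma df_ext a b : (forall e, a e = b e) -> df a -> df b.
Proof. intros H. apply sa_ext. intros e. now rewrite H. Qed.

(** Substituting definable functions costs one existential quantifier per argument, since only their
    graphs are available. *)
Lemma sa_app2 (P : R -> R -> Prop) a b :
  sa (fun e => P (e O) (e (S O))) -> df a -> df b -> sa (fun e => P (a e) (b e)).
Proof.
  intros HP Ha Hb.
  apply sa_ext with (fun e => exists x, x = a e /\ exists y, y = b e /\ P x y).
  - intros e. split.
    + intros [x [-> [y [-> H]]]]. auto.
    + intros H. exists (a e). split; auto. exists (b e). auto.
  - apply sa_ex. apply sa_and; [exact Ha|].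
    apply (sa_ex (fun e y => y = b (shift e) /\ P (e O) y)).
    apply sa_and; [exact (df_shift _ Hb)|].
    exact (sa_rename (fun i => match i with O => S O | _ => O end) _ HP).
Qed.

Lemma df_app1 (h : R -> R) a : df (fun e => h (e O)) -> df a -> df (fun e => h (a e)).
Proof.
  intros Hh Ha. unfold df.
  apply (sa_app2 (fun v x => v = h x) (fun e => e O) (fun e => a (shift e))).
  - exact Hh.
  - apply df_var.
  - apply df_shift, Ha.
Qed.

Lemma df_app2 (h : R -> R -> R) a b :
  df (fun e => h (e O) (e (S O))) -> df a -> df b -> df (fun e => h (a e) (b e)).
Proof.
  intros Hh Ha Hb. unfold df.
  apply sa_ext with (fun e => exists x, x = a (shift e) /\ e O = h x (b (shift e))).
  - intros e. split.
    + intros [x [-> H]]. auto.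
    + intros H. exists (a (shift e)). auto.
  - apply (sa_ex (fun e x => x = a (shift e) /\ e O = h x (b (shift e)))).
    apply sa_and.
    + exact (sa_rename (fun i => match i with O => O | S j => S (S j) end) _ Ha).
    + apply sa_ext with (fun e => exists y, y = b (shift (shift e)) /\ e (S O) = h (e O) y).
      * intros e. split.
        -- intros [y [-> H]]. exact H.
        -- intros H. exists (b (shift (shift e))). auto.
      * apply (sa_ex (fun e y => y = b (shift (shift e)) /\ e (S O) = h (e O) y)).
        apply sa_and.
        -- exact (df_shift _ (df_shift _ Hb)).
        -- exact (sa_rename (fun i => match i with O => 2 | 1 => 1 | _ => O end)%nat _ Hh).
Qed.

Lemma sa_lt a b : df a -> df b -> sa (fun e => a e < b e).
Proof.
  apply (sa_app2 Rlt).
  apply sa_ext with (fun e => 0 < peval (PAdd (PVar 1) (POpp (PVar 0))) e);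
    [|apply sa_pos].
  intros e. simpl. lra.
Qed.

Lemma sa_le a b : df a -> df b -> sa (fun e => a e <= b e).
Proof.
  intros Ha Hb. apply sa_ext with (fun e => ~ b e < a e).
  - intros e. lra.
  - now apply sa_not, sa_lt.
Qed.

Lemma sa_eq a b : df a -> df b -> sa (fun e => a e = b e).
Proof.
  intros Ha Hb. apply sa_ext with (fun e => a e <= b e /\ b e <= a e).
  - intros e. lra.
  - now apply sa_and; apply sa_le.
Qed.

Lemma df_plus a b : df a -> df b -> df (fun e => a e + b e).
Proof.
  apply (df_app2 Rplus).
  apply sa_ext with (fun e => peval (PAdd (PVar 0) (POpp (PAdd (PVar 1) (PVar 2)))) e = 0);
    [|apply sa_zero].
  intros e. unfold shift. simpl. lra.
Qed.

Lemma df_mult a b : df a -> df b -> df (fun e => a e * b e).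
Proof.
  apply (df_app2 Rmult).
  apply sa_ext with (fun e => peval (PAdd (PVar 0) (POpp (PMul (PVar 1) (PVar 2)))) e = 0);
    [|apply sa_zero].
  intros e. unfold shift. simpl. lra.
Qed.

Lemma df_minus a b : df a -> df b -> df (fun e => a e - b e).
Proof.
  intros Ha Hb. apply df_ext with (fun e => a e + (-1) * b e).
  - intros e. lra.
  - apply df_plus; [|apply df_mult]; auto using df_const.
Qed.

(* The witness of [epsilon] is a fixed real wherever [Q e] is empty, so no
   existence hypothesis is needed. *)
Lemma df_epsilon (Q : (nat -> R) -> R -> Prop) :
  (forall e x y, Q e x -> Q e y -> x = y) ->
  sa (fun e => Q (shift e) (e O)) ->
  df (fun e => epsilon (inhabits 0) (Q e)).
Proof.
  intros Hu HQ.
  set (c := epsilon (inhabits 0) (fun _ : R => False)).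
  unfold df.
  apply sa_ext with (fun e => Q (shift e) (e O) \/
    ((~ exists x, Q (shift e) x) /\ e O = c)).
  - intros e. destruct (classic (exists x, Q (shift e) x)) as [H|H].
    + pose proof (epsilon_spec (inhabits 0) _ H) as Hs.
      split.
      * intros [H1|[H1 _]]; [eapply Hu; eauto|tauto].
      * intros ->. now left.
    + assert (E : Q (shift e) = fun _ => False).
      { apply functional_extensionality. intros x.
        apply propositional_extensionality. split; [|tauto].
        intros Hx. apply H. now exists x. }
      rewrite E. fold c. firstorder.
  - apply sa_or; [exact HQ|]. apply sa_and.
    + apply sa_not, (sa_ex (fun e => Q (shift e))).
      exact (sa_rename (fun i => match i with O => O | S j => S (S j) end) _ HQ).
    + apply sa_eq; [apply df_var|apply df_const].
Qed.

Lemma df_abs a : df a -> df (fun e => Rabs (a e)).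
Proof.
  apply (df_app1 Rabs). unfold df, shift.
  apply sa_ext with (fun e => 0 <= e O /\ (e O - e (S O)) * (e O + e (S O)) = 0).
  - intros e. set (x := e O). set (y := e (S O)). split.
    + intros [H1 H2]. apply Rmult_integral in H2.
      unfold Rabs. destruct (Rcase_abs y); lra.
    + intros ->. unfold Rabs. destruct (Rcase_abs y); split; try lra; nra.
  - apply sa_and.
    + apply sa_le; auto using df_const, df_var.
    + apply sa_eq; auto using df_const, df_var, df_mult, df_minus, df_plus.
Qed.

Lemma df_sqrt a : df a -> df (fun e => sqrt (a e)).
Proof.
  apply (df_app1 sqrt). unfold df, shift.
  (* [sqrt] is 0 on negative reals, so the graph needs a separate branch there. *)
  apply sa_ext with (fun e => 0 <= e O /\
    ((0 <= e (S O) /\ e O * e O = e (S O)) \/ (e (S O) < 0 /\ e O = 0))).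
  - intros e. set (x := e O). set (y := e (S O)). split.
    + intros [H1 [[H2 H3]|[H2 H3]]].
      * rewrite <- H3, sqrt_square; auto.
      * rewrite H3, sqrt_neg_0; lra.
    + intros ->. split; [apply sqrt_pos|].
      destruct (Rlt_le_dec y 0) as [H|H].
      * right. split; auto. apply sqrt_neg_0. lra.
      * left. split; auto. now apply sqrt_sqrt.
  - apply sa_and; [|apply sa_or; apply sa_and];
      auto using sa_le, sa_lt, sa_eq, df_const, df_var, df_mult.
Qed.

Lemma df_sumR k (a : nat -> (nat -> R) -> R) :
  (forall i, (i < k)%nat -> df (a i)) -> df (fun e => sumR k (fun i => a i e)).
Proof.
  induction k as [|k IH]; intros H; simpl.
  - apply df_const.
  - apply df_plus; auto.
Qed.

(** * Definability with vector variables *)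

Definition vdf {n} (X : (nat -> R) -> vec n) : Prop :=
  forall i, (i < n)%nat -> df (fun e => vc (X e) i).

Lemma vec_ext {n} (x y : vec n) :
  (forall i, (i < n)%nat -> vc x i = vc y i) -> x = y.
Proof.
  destruct x as [x Hx], y as [y Hy]. unfold vc. simpl. intros H.
  assert (E : x = y).
  { apply functional_extensionality. intros i.
    destruct (le_lt_dec n i) as [Hi|Hi]; auto. rewrite Hx, Hy; auto. }
  subst y. f_equal. apply proof_irrelevance.
Qed.

Definition mkvec (n : nat) (x : nat -> R) : vec n.
Proof.
  exists (fun i => if Nat.ltb i n then x i else 0).
  intros i Hi. destruct (Nat.ltb_spec i n); [lia|reflexivity].
Defined.

Lemma vc_mkvec n x i : (i < n)%nat -> vc (mkvec n x) i = x i.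
Proof.
  intros Hi. unfold vc, mkvec. simpl. destruct (Nat.ltb_spec i n); [reflexivity|lia].
Qed.

Definition vshift (n : nat) (e : nat -> R) : nat -> R := fun i => e (n + i)%nat.

(** A vector quantifier is [n] real quantifiers whose bound variables occupy the first [n] indices.
    The induction inserts them one at a time: [cat k x e] puts [k] entries of [x] in front of [e],
    and the next variable becomes entry [k]. *)
Lemma sa_ex_vec {n} (Q : (nat -> R) -> vec n -> Prop) :
  sa (fun e => Q (vshift n e) (mkvec n e)) -> sa (fun e => exists x, Q e x).
Proof.
  set (cat := fun k (x : nat -> R) (e : nat -> R) i =>
                if Nat.ltb i k then x i else e (i - k)%nat).
  assert (H : forall P k, sa P -> sa (fun e => exists x, P (cat k x e))).
  { intros P k HP. induction k as [|k IH].
    - apply sa_ext with P; [|exact HP]. intros e.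
      assert (E : forall x, cat O x e = e).
      { intros x. apply functional_extensionality. intros i.
        unfold cat. simpl. f_equal. lia. }
      split; [intros H; exists (fun _ => 0); now rewrite E|].
      intros [x Hx]. now rewrite E in Hx.
    - apply sa_ext with (fun e => exists t, exists x, P (cat k x (scons t e))).
      + intros e. split.
        * intros [t [x Hx]]. exists (fun i => if Nat.ltb i k then x i else t).
          replace (cat (S k) _ e) with (cat k x (scons t e)); [exact Hx|].
          apply functional_extensionality. intros i. unfold cat, scons.
          destruct (Nat.ltb_spec i k); destruct (Nat.ltb_spec i (S k)); try lia; auto.
          -- replace (i - k)%nat with O by lia. auto.
          -- replace (i - k)%nat with (S (i - S k)) by lia. auto.
        * intros [x Hx]. exists (x k), x.
          replace (cat k x (scons (x k) e)) with (cat (S k) x e); [exact Hx|].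
          apply functional_extensionality. intros i. unfold cat, scons.
          destruct (Nat.ltb_spec i k); destruct (Nat.ltb_spec i (S k)); try lia; auto.
          -- replace (i - k)%nat with O by lia. f_equal. lia.
          -- replace (i - k)%nat with (S (i - S k)) by lia. auto.
      + apply (sa_ex (fun e t => exists x, P (cat k x (scons t e)))).
        apply sa_ext with (2 := IH).
        intros e. replace (scons (e O) (shift e)) with e; [tauto|].
        apply functional_extensionality. intros [|i]; reflexivity. }
  intros HQ. apply (H _ n) in HQ. apply sa_ext with (2 := HQ).
  intros e.
  assert (E : forall x, vshift n (cat n x e) = e).
  { intros x. apply functional_extensionality. intros i. unfold vshift, cat.
    destruct (Nat.ltb_spec (n + i) n); [lia|]. f_equal. lia. }
  assert (E' : forall x, mkvec n (cat n x e) = mkvec n x).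
  { intros x. apply vec_ext. intros i Hi. rewrite !vc_mkvec by assumption.
    unfold cat. destruct (Nat.ltb_spec i n); [reflexivity|lia]. }
  split.
  - intros [x Hx]. rewrite E, E' in Hx. now exists (mkvec n x).
  - intros [x Hx]. exists (vc x). rewrite E, E'.
    replace (mkvec n (vc x)) with x; auto.
    apply vec_ext. intros i Hi. now rewrite vc_mkvec.
Qed.

Lemma sa_all_vec {n} (Q : (nat -> R) -> vec n -> Prop) :
  sa (fun e => Q (vshift n e) (mkvec n e)) -> sa (fun e => forall x, Q e x).
Proof.
  intros H. apply sa_ext with (fun e => ~ exists x, ~ Q e x).
  - intros e. split.
    + intros Hn x. apply NNPP. intros Hx. apply Hn. now exists x.
    + intros Ha [x Hx]. auto.
  - apply sa_not, sa_ex_vec, sa_not, H.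
Qed.

Lemma vdf_const {n} (x : vec n) : vdf (fun _ => x).
Proof. intros i _. apply df_const. Qed.

Lemma vdf_mkvec n (r : nat -> nat) : vdf (fun e => mkvec n (fun i => e (r i))).
Proof.
  intros i Hi. apply df_ext with (fun e => e (r i)); [|apply df_var].
  intros e. now rewrite vc_mkvec.
Qed.

Lemma vdf_rename {n} (r : nat -> nat) (X : (nat -> R) -> vec n) :
  vdf X -> vdf (fun e => X (fun i => e (r i))).
Proof. intros H i Hi. exact (df_rename r _ (H i Hi)). Qed.

Lemma vdf_shift {n} (X : (nat -> R) -> vec n) : vdf X -> vdf (fun e => X (shift e)).
Proof. intros H i Hi. exact (df_shift _ (H i Hi)). Qed.

Lemma vdf_vshift {n} m (X : (nat -> R) -> vec n) :
  vdf X -> vdf (fun e => X (vshift m e)).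
Proof. intros H i Hi. exact (df_rename (fun i => (m + i)%nat) _ (H i Hi)). Qed.

Lemma df_vshift m a : df a -> df (fun e => a (vshift m e)).
Proof. exact (df_rename (fun i => (m + i)%nat) a). Qed.

Lemma df_dist {n} (X Y : (nat -> R) -> vec n) :
  vdf X -> vdf Y -> df (fun e => dist (X e) (Y e)).
Proof.
  intros HX HY. apply df_sqrt, df_sumR. intros i Hi.
  apply df_ext with (fun e => (vc (X e) i - vc (Y e) i) * (vc (X e) i - vc (Y e) i)).
  - intros e. ring.
  - apply df_mult; apply df_minus; auto.
Qed.

Lemma df_semialgebraic_fun {n} (f : vec n -> R) (X : (nat -> R) -> vec n) :
  semialgebraic_fun f -> vdf X -> df (fun e => f (X e)).
Proof.
  intros [L HL] HX. unfold df.
  apply sa_ext with (fun e => exists x : vec n,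
    (forall i, (i < n)%nat -> vc x i = vc (X (shift e)) i) /\ e O = f x).
  - intros e. split.
    + intros [x [H1 H2]]. now rewrite <- (vec_ext _ _ H1).
    + intros H. exists (X (shift e)). auto.
  - apply (sa_ex_vec (fun e x =>
      (forall i, (i < n)%nat -> vc x i = vc (X (shift e)) i) /\ e O = f x)).
    apply sa_and.
    + apply sa_forall_lt. intros i Hi. apply sa_eq.
      * exact (vdf_mkvec n (fun i => i) i Hi).
      * exact (vdf_vshift n _ (vdf_shift _ HX) i Hi).
    (* The hypothesis on [f] speaks only of points [pt x t]. The substitution reproduces such a
       point: coordinates below [n], the value at index [n], zeros beyond. *)
    + apply sa_ext with (fun e => exists B, In B L /\ basic_sa B
        (fun i => peval (if Nat.ltb i n then PVar i
           else if Nat.eqb i n then PVar n else PConst 0) e)).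
      * intros e. rewrite HL.
        replace (pt (mkvec n e) (vshift n e O)) with
          (fun i => peval (if Nat.ltb i n then PVar i
             else if Nat.eqb i n then PVar n else PConst 0) e); [tauto|].
        apply functional_extensionality. intros i. unfold pt.
        destruct (Nat.ltb_spec i n); [now rewrite vc_mkvec|].
        destruct (Nat.eqb i n); [|reflexivity].
        unfold vshift. simpl. f_equal. lia.
      * apply sa_exists_in. intros B.
        apply (sa_subst _ (basic_sa B)). apply sa_and; apply sa_forall_in.
        -- intros p. apply sa_zero.
        -- intros p. apply sa_pos.
Qed.

Lemma is_lub_eq E x y : is_lub E x -> is_lub E y -> x = y.
Proof. intros [H1 H2] [H3 H4]. apply Rle_antisym; auto. Qed.

Lemma df_robust_reg {n} (f : vec n -> R) a (X : (nat -> R) -> vec n) :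
  semialgebraic_fun f -> df a -> vdf X -> df (fun e => robust_reg f (a e) (X e)).
Proof.
  intros Hf Ha HX. unfold robust_reg, supR.
  apply (df_epsilon (fun e s => is_lub (fun v => exists x', dist x' (X e) <= a e /\ v = f x') s)).
  - intros e x y. apply is_lub_eq.
  - assert (U : forall Y b c, vdf Y -> df b -> df c -> sa (fun e =>
      is_upper_bound (fun v => exists x', dist x' (Y e) <= b e /\ v = f x') (c e))).
    { intros Y b c HY Hb Hc. apply sa_ext with (fun e =>
        forall x', dist x' (Y e) <= b e -> f x' <= c e).
      - intros e. split.
        + intros H v [x' [H1 ->]]. auto.
        + intros H x' H1. apply H. now exists x'.
      - apply (sa_all_vec (fun e x' => dist x' (Y e) <= b e -> f x' <= c e)).
        apply sa_imp; apply sa_le.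
        + apply df_dist; [apply (vdf_mkvec n (fun i => i))|now apply vdf_vshift].
        + now apply df_vshift.
        + apply df_semialgebraic_fun; [exact Hf|apply (vdf_mkvec n (fun i => i))].
        + now apply df_vshift. }
    apply sa_and.
    + apply U; [now apply vdf_shift|now apply df_shift|apply df_var].
    + apply (sa_all (fun e b => is_upper_bound (fun v =>
        exists x', dist x' (X (shift e)) <= a (shift e) /\ v = f x') b -> e O <= b)).
      apply sa_imp.
      * exact (U _ _ _ (vdf_shift _ (vdf_shift _ HX)) (df_shift _ (df_shift _ Ha)) (df_var O)).
      * exact (sa_le _ _ (df_var 1) (df_var 0)).
Qed.

(** Below several quantifiers, variables and given functions appear under iterated shifts. Unfolding
    [shift] and [vshift] exposes a renaming [r] of indices, to which the renaming lemmas apply. *)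
Ltac sa_step :=
  match goal with
  | H : sa _ |- sa _ => exact H
  | H : df _ |- df _ => exact H
  | H : vdf _ |- vdf _ => exact H
  | |- sa (fun _ => _ /\ _) => apply sa_and
  | |- sa (fun _ => _ \/ _) => apply sa_or
  | |- sa (fun _ => ~ _) => apply sa_not
  | |- sa (fun _ => _ -> _) => apply sa_imp
  | |- sa (fun _ => exists _ : R, _) => apply sa_ex
  | |- sa (fun _ => forall _ : R, _) => apply sa_all
  | |- sa (fun _ => exists _ : vec _, _) => apply sa_ex_vec
  | |- sa (fun _ => forall _ : vec _, _) => apply sa_all_vec
  | |- sa (fun _ => _ < _) => apply sa_lt
  | |- sa (fun _ => _ <= _) => apply sa_le
  | |- sa (fun _ => @eq R _ _) => apply sa_eq
  | |- df (fun _ => _ + _) => apply df_plus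
  | |- df (fun _ => _ - _) => apply df_minus
  | |- df (fun _ => _ * _) => apply df_mult
  | |- df (fun _ => Rabs _) => apply df_abs
  | |- df (fun _ => dist _ _) => apply df_dist
  | |- vdf (fun _ => ?x) => apply (vdf_const x)
  | |- vdf (fun e => mkvec ?n e) => apply (vdf_mkvec n (fun i => i))
  | |- vdf (mkvec ?n) => apply (vdf_mkvec n (fun i => i))
  | |- vdf ?f =>
      let f' := eval cbv beta delta [shift vshift] in f in
      match f' with (fun e => mkvec ?n (fun i => e (@?r i))) => exact (vdf_mkvec n r) end
  | H : vdf ?X |- vdf (fun e => ?X (@?T e)) =>
      let T' := eval cbv beta delta [shift vshift] in T in
      match T' with (fun e => fun i => e (@?r i)) => exact (vdf_rename r X H) end
  | |- df (fun _ => ?c) => apply (df_const c)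
  | |- df ?f =>
      let f' := eval cbv beta delta [shift vshift] in f in
      match f' with (fun e => e ?k) => exact (df_var k) end
  | H : df ?a |- df (fun e => ?a (@?T e)) =>
      let T' := eval cbv beta delta [shift vshift] in T in
      match T' with (fun e => fun i => e (@?r i)) => exact (df_rename r a H) end
  | |- sa (fun _ => ?P) => apply (sa_const P)
  end.

Lemma sa_app3 (P : R -> R -> R -> Prop) a b c :
  sa (fun e => P (e O) (e (S O)) (e 2%nat)) -> df a -> df b -> df c ->
  sa (fun e => P (a e) (b e) (c e)).
Proof.
  intros HP Ha Hb Hc.
  apply sa_ext with (fun e =>
    exists x, x = a e /\ exists y, y = b e /\ exists z, z = c e /\ P x y z).
  - intros e. split.
    + intros [x [-> [y [-> [z [-> H]]]]]]. exact H.
    + intros H. exists (a e). split; auto. exists (b e). split; auto. now exists (c e).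
  - repeat sa_step.
    exact (sa_rename (fun i => match i with O => 2 | 1 => 1 | _ => O end)%nat _ HP).
Qed.

(** * Tameness in one variable *)

(** Germs at 0 from the right. Behaviour to the left of a point [x] is expressed with the same
    predicate through [x - t]. *)
Definition ev (p : R -> Prop) : Prop :=
  exists d, 0 < d /\ forall t, 0 < t < d -> p t.

Lemma ev_and p q : ev p -> ev q -> ev (fun t => p t /\ q t).
Proof.
  intros [d [Hd H]] [d' [Hd' H']].
  exists (Rmin d d'). split; [now apply Rmin_glb_lt|].
  intros t Ht. pose proof (Rmin_l d d'). pose proof (Rmin_r d d').
  split; [apply H|apply H']; lra.
Qed.

Lemma ev_imp (p q : R -> Prop) : (forall t, 0 < t -> p t -> q t) -> ev p -> ev q.
Proof. intros H [d [Hd Hp]]. exists d. split; auto. intros t Ht. apply H, Hp; lra. Qed.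

Lemma ev_lt d : 0 < d -> ev (fun t => t < d).
Proof. intros H. exists d. split; auto. intros t Ht. lra. Qed.

Lemma ev_ex p : ev p -> exists t, 0 < t /\ p t.
Proof. intros [d [Hd H]]. exists (d / 2). split; [lra|apply H; lra]. Qed.

Lemma sa_ev (Q : (nat -> R) -> R -> Prop) :
  sa (fun e => Q (shift e) (e O)) -> sa (fun e => ev (Q e)).
Proof.
  intros H. unfold ev. repeat sa_step.
  exact (sa_rename (fun i => match i with O => O | S j => S (S j) end) _ H).
Qed.

(** * Signs of polynomials just to the right of a point *)

Fixpoint horner (l : list R) (t : R) : R :=
  match l with nil => 0 | c :: l => c + t * horner l t end.

Lemma horner_add l m : exists k, forall t, horner k t = horner l t + horner m t.
Proof.
  revert m. induction l as [|c l IH]; intros m.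
  - exists m. intros t. simpl. ring.
  - destruct m as [|c' m].
    + exists (c :: l). intros t. simpl. ring.
    + destruct (IH m) as [k Hk]. exists (c + c' :: k).
      intros t. simpl. rewrite Hk. ring.
Qed.

Lemma horner_scale c l : exists k, forall t, horner k t = c * horner l t.
Proof.
  induction l as [|a l [k IH]].
  - exists nil. intros t. simpl. ring.
  - exists (c * a :: k). intros t. simpl. rewrite IH. ring.
Qed.

Lemma horner_mul l m : exists k, forall t, horner k t = horner l t * horner m t.
Proof.
  induction l as [|c l [k IH]].
  - exists nil. intros t. simpl. ring.
  - destruct (horner_scale c m) as [k1 H1].
    destruct (horner_add k1 (0 :: k)) as [k2 H2].
    exists k2. intros t. rewrite H2. simpl. rewrite H1, IH. ring.
Qed.

Lemma peval_line_horner p a :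
  exists l, forall t, peval p (scons (a + t) (fun _ => 0)) = horner l t.
Proof.
  induction p as [c|[|i]|p [l Hl] q [m Hm]|p [l Hl] q [m Hm]|p [l Hl]]; simpl.
  - exists (c :: nil). intros t. simpl. ring.
  - exists (a :: 1 :: nil). intros t. simpl. ring.
  - exists nil. reflexivity.
  - destruct (horner_add l m) as [k Hk]. exists k. intros t. now rewrite Hl, Hm, Hk.
  - destruct (horner_mul l m) as [k Hk]. exists k. intros t. now rewrite Hl, Hm, Hk.
  - destruct (horner_scale (-1) l) as [k Hk]. exists k. intros t. rewrite Hl, Hk. ring.
Qed.

Lemma horner_bounded l : exists M, 0 < M /\ forall t, 0 < t < 1 -> Rabs (horner l t) <= M.
Proof.
  induction l as [|c l [M [HM IH]]].
  - exists 1. split; [lra|]. intros t _. simpl. rewrite Rabs_R0. lra.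
  - exists (Rabs c + M). split; [pose proof (Rabs_pos c); lra|].
    intros t Ht. simpl. eapply Rle_trans; [apply Rabs_triang|].
    rewrite Rabs_mult, (Rabs_pos_eq t) by lra.
    specialize (IH t Ht). pose proof (Rabs_pos (horner l t)). nra.
Qed.

(** A nonzero constant coefficient dominates the rest for small [t]. If it vanishes, the polynomial
    is [t] times its tail and has the sign of the tail. *)
Lemma horner_sign l :
  ev (fun t => horner l t = 0) \/ ev (fun t => 0 < horner l t) \/ ev (fun t => horner l t < 0).
Proof.
  induction l as [|c l IH].
  - left. exists 1. split; [lra|]. reflexivity.
  - destruct (Req_dec c 0) as [->|Hc].
    + destruct IH as [H|[H|H]]; [left|right; left|right; right];
        revert H; apply ev_imp; simpl; intros t Ht H; nra.
    + right. destruct (horner_bounded l) as [M [HM HB]].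
      assert (H : ev (fun t => Rabs (t * horner l t) < Rabs c)).
      { assert (Hd : 0 < Rabs c / (M + 1)).
        { apply Rdiv_lt_0_compat; [now apply Rabs_pos_lt|lra]. }
        refine (ev_imp _ _ _ (ev_and _ _ (ev_lt 1 Rlt_0_1) (ev_lt _ Hd))).
        intros t Ht [H1 H2]. rewrite Rabs_mult, (Rabs_pos_eq t) by lra.
        assert (H3 : t * (M + 1) < Rabs c).
        { apply (Rmult_lt_compat_r (M + 1)) in H2; [|lra].
          replace (Rabs c / (M + 1) * (M + 1)) with (Rabs c) in H2 by (field; lra). lra. }
        specialize (HB t (conj Ht H1)). nra. }
      destruct (Rtotal_order c 0) as [H0|[H0|H0]]; [right|tauto|left];
        revert H; apply ev_imp; simpl; intros t Ht H; apply Rabs_def2 in H.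
      * rewrite Rabs_left in H by lra. lra.
      * rewrite Rabs_pos_eq in H by lra. lra.
Qed.

(** Definable predicates are quantifier-free by the definition of [sa]. Atoms are settled by
    [horner_sign], and the dichotomy is stable under negation and conjunction. *)
Lemma tame p a :
  sa (fun e => p (e O)) -> ev (fun t => p (a + t)) \/ ev (fun t => ~ p (a + t)).
Proof.
  intros [f Hf].
  assert (H : ev (fun t => qeval f (scons (a + t) (fun _ => 0))) \/
              ev (fun t => ~ qeval f (scons (a + t) (fun _ => 0)))).
  { clear Hf. induction f as [q|q|f [IH|IH]|f [IHf|IHf] g [IHg|IHg]]; simpl.
    - destruct (peval_line_horner q a) as [l Hl].
      destruct (horner_sign l) as [H|[H|H]]; [left|right|right];
        revert H; apply ev_imp; intros t _ H; rewrite Hl; lra.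
    - destruct (peval_line_horner q a) as [l Hl].
      destruct (horner_sign l) as [H|[H|H]]; [right|left|right];
        revert H; apply ev_imp; intros t _ H; rewrite Hl; lra.
    - right. revert IH. apply ev_imp. tauto.
    - left. exact IH.
    - left. now apply ev_and.
    - right. revert IHg. apply ev_imp. tauto.
    - right. revert IHf. apply ev_imp. tauto.
    - right. revert IHf. apply ev_imp. tauto. }
  destruct H as [H|H]; [left|right]; revert H; apply ev_imp;
    intros t _; rewrite <- Hf; auto.
Qed.

Lemma ev_tame p : sa (fun e => p (e O)) -> ev p \/ ev (fun t => ~ p t).
Proof.
  intros H. destruct (tame p 0 H) as [H'|H']; [left|right];
    revert H'; apply ev_imp; intros t _; now rewrite Rplus_0_l.
Qed.

Lemma not_ev_tame p : sa (fun e => p (e O)) -> ~ ev p -> ev (fun t => ~ p t).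
Proof. intros H H'. destruct (ev_tame p H); tauto. Qed.

Lemma tame_interval p a b : a < b -> sa (fun e => p (e O)) ->
  exists a' b', a < a' < b' /\ b' < b /\
    ((forall r, a' <= r <= b' -> p r) \/ (forall r, a' <= r <= b' -> ~ p r)).
Proof.
  intros Hab H. assert (Hd : 0 < b - a) by lra.
  destruct (tame p a H) as [H'|H'];
    destruct (ev_and _ _ H' (ev_lt _ Hd)) as [d [Hd' HH]];
    exists (a + Rmin d (b - a) / 3), (a + Rmin d (b - a) / 2);
    assert (0 < Rmin d (b - a)) by (now apply Rmin_glb_lt);
    pose proof (Rmin_l d (b - a)); pose proof (Rmin_r d (b - a));
    (split; [lra|split; [lra|]]); [left|right];
    intros r Hr; replace r with (a + (r - a)) by ring; apply HH; lra.
Qed.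

(* Baire: if no [P k] contained a subinterval, tameness would give nested
   compact intervals, the k-th one disjoint from [P k]. *)
Lemma tame_cover (P : nat -> R -> Prop) a b : a < b ->
  (forall k, sa (fun e => P k (e O))) ->
  (forall r, a < r < b -> exists k, P k r) ->
  exists k a' b', a < a' < b' /\ b' < b /\ forall r, a' <= r <= b' -> P k r.
Proof.
  intros Hab HP Hc. apply NNPP. intros Hn.
  (* The bounds on the endpoints are stored in the type, so that the nested intervals can be defined
     by plain recursion from a chosen successor function. *)
  assert (step : forall k (I : {I : R * R | a <= fst I < snd I /\ snd I <= b}),
    {J : {J : R * R | a <= fst J < snd J /\ snd J <= b} |
      fst (proj1_sig I) < fst (proj1_sig J) /\ snd (proj1_sig J) < snd (proj1_sig I) /\
      forall r, fst (proj1_sig J) <= r <= snd (proj1_sig J) -> ~ P k r}).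
  { intros k [[c d] HI]. simpl in *. apply constructive_indefinite_description.
    destruct (tame_interval (P k) c d (proj2 (proj1 HI)) (HP k)) as (c' & d' & H1 & H2 & [H3|H3]).
    - exfalso. apply Hn. exists k, c', d'. split; [lra|]. split; [lra|auto].
    - assert (HJ : a <= fst (c', d') < snd (c', d') /\ snd (c', d') <= b) by (simpl; lra).
      exists (exist _ (c', d') HJ). simpl. split; [lra|]. split; [lra|auto]. }
  assert (H0 : a <= fst (a, b) < snd (a, b) /\ snd (a, b) <= b) by (simpl; lra).
  pose (I := fix I k := match k with
    | O => exist _ (a, b) H0 | S k => proj1_sig (step k (I k)) end).
  pose (l := fun k => fst (proj1_sig (I k))). pose (u := fun k => snd (proj1_sig (I k))).
  assert (HI : forall k, l k < l (S k) /\ u (S k) < u k /\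
      forall r, l (S k) <= r <= u (S k) -> ~ P k r).
  { intros k. unfold l, u. simpl. destruct (step k (I k)) as [J HJ]. exact HJ. }
  assert (Hlu : forall k, a <= l k < u k /\ u k <= b).
  { intros k. unfold l, u. destruct (I k) as [J HJ]. exact HJ. }
  assert (Hl : forall k j, l k <= l (k + j)%nat /\ u (k + j)%nat <= u k).
  { intros k j. induction j as [|j IH].
    - rewrite Nat.add_0_r. lra.
    - rewrite Nat.add_succ_r. specialize (HI (k + j)%nat). lra. }
  assert (Hm : forall k j, l k <= u j).
  { intros k j. destruct (le_lt_dec k j) as [H|H].
    - replace j with (k + (j - k))%nat by lia.
      specialize (Hl k (j - k)%nat). specialize (Hlu (k + (j - k))%nat). lra.
    - replace k with (j + (k - j))%nat by lia.
      specialize (Hl j (k - j)%nat). specialize (Hlu (j + (k - j))%nat). lra. }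
  destruct (completeness (fun v => exists k, v = l k)) as [r [Hr1 Hr2]].
  - exists (u O). intros v [k ->]. apply Hm.
  - exists (l O). now exists O.
  - assert (Hr : forall k, l k <= r <= u k).
    { intros k. split; [apply Hr1; now exists k|].
      apply Hr2. intros v [j ->]. apply Hm. }
    destruct (Hc r) as [k Hk].
    + pose proof (HI O). pose proof (Hr 1%nat). pose proof (Hlu O). lra.
    + exact (proj2 (proj2 (HI k)) r (Hr (S k)) Hk).
Qed.

Lemma archimed_inv d : 0 < d -> exists k : nat, / INR (S k) < d.
Proof.
  intros Hd. destruct (archimed_cor1 d Hd) as [N [HN HN']].
  exists (pred N). now replace (S (pred N)) with N by lia.
Qed.

(** The radii for which the threshold [/ INR (S k)] works cover the interval as [k] varies, so a
    single threshold serves a whole subinterval. *)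
Lemma tame_uniform (P : R -> R -> Prop) a b : a < b ->
  sa (fun e => P (e O) (e (S O))) ->
  (forall r, a < r < b -> ev (P r)) ->
  exists d a' b', 0 < d /\ a < a' < b' /\ b' < b /\
    forall r t, a' <= r <= b' -> 0 < t < d -> P r t.
Proof.
  intros Hab HP H.
  destruct (tame_cover (fun k r => forall t, 0 < t -> t < / INR (S k) -> P r t) a b)
    as (k & a' & b' & H1 & H2 & H3); auto.
  - intros k. repeat sa_step.
    exact (sa_rename (fun i => match i with O => S O | _ => O end) _ HP).
  - intros r Hr. destruct (H r Hr) as [d [Hd Hp]].
    destruct (archimed_inv d Hd) as [k Hk]. exists k.
    intros t Ht Ht'. apply Hp. lra.
  - exists (/ INR (S k)), a', b'.
    split; [apply Rinv_0_lt_compat, lt_0_INR; lia|].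
    split; [lra|]. split; [lra|]. intros r t Hr Ht. apply H3; tauto.
Qed.

Lemma sa_swap (P : R -> R -> Prop) :
  sa (fun e => P (e O) (e (S O))) -> sa (fun e => P (e (S O)) (e O)).
Proof.
  exact (sa_rename (fun i => match i with O => S O | _ => O end)
    (fun e => P (e O) (e (S O)))).
Qed.

Lemma tame_pairs (P : R -> R -> Prop) a b : a < b ->
  sa (fun e => P (e O) (e (S O))) ->
  (forall r, a < r < b -> ev (fun t => P r (r + t))) ->
  exists a' b', a < a' < b' /\ b' < b /\
    forall r s, a' <= r -> r < s -> s <= b' -> P r s.
Proof.
  intros Hab HP H.
  destruct (tame_uniform (fun r t => P r (r + t)) a b Hab)
    as (d & a' & b' & Hd & H1 & H2 & H3); auto.
  - apply (sa_app2 P); auto; repeat sa_step.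
  (* An interval shorter than the common threshold [d]: any two of its points differ by less than
     [d]. *)
  - exists a', (Rmin b' (a' + d / 2)).
    pose proof (Rmin_l b' (a' + d / 2)). pose proof (Rmin_r b' (a' + d / 2)).
    assert (a' < Rmin b' (a' + d / 2)) by (apply Rmin_glb_lt; lra).
    split; [lra|]. split; [lra|]. intros r s Hr Hrs Hs.
    replace s with (r + (s - r)) by ring. apply H3; lra.
Qed.

(* For each [r], [P r s] has a constant truth value for [s] slightly above [r]. *)
Lemma tame_ramsey (P : R -> R -> Prop) a b : a < b ->
  sa (fun e => P (e O) (e (S O))) ->
  exists a' b', a < a' < b' /\ b' < b /\
    ((forall r s, a' <= r -> r < s -> s <= b' -> P r s) \/
     (forall r s, a' <= r -> r < s -> s <= b' -> ~ P r s)).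
Proof.
  intros Hab HP.
  assert (HP1 : forall r, sa (fun e => P r (r + e O))).
  { intros r. apply (sa_app2 P); auto; repeat sa_step. }
  destruct (tame_interval (fun r => ev (fun t => P r (r + t))) a b Hab)
    as (a' & b' & H1 & H2 & [H3|H3]).
  - apply sa_ev. apply (sa_app2 P); auto; repeat sa_step.
  - destruct (tame_pairs P a' b') as (c & d & H4 & H5 & H6); try tauto.
    + intros r Hr. apply H3. lra.
    + exists c, d. split; [lra|]. split; [lra|now left].
  - destruct (tame_pairs (fun r s => ~ P r s) a' b') as (c & d & H4 & H5 & H6); try tauto.
    + now apply sa_not.
    + intros r Hr. apply (not_ev_tame (fun t => P r (r + t))); auto. apply H3. lra.
    + exists c, d. split; [lra|]. split; [lra|now right].
Qed.

(** * From local to global relations on an interval *)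

Definition locally_on (P : R -> R -> Prop) (r : R) : Prop :=
  exists d, 0 < d /\ forall x y, r - d < x -> x < y -> y < r + d -> P x y.

(** A supremum argument in which transitivity glues neighbourhoods together. It serves both for
    slope comparisons and, in [continuous_bounded], as compactness of an interval. *)
Lemma local_to_global (P : R -> R -> Prop) a b :
  (forall x y z, x < y -> y < z -> P x y -> P y z -> P x z) ->
  (forall r, a <= r <= b -> locally_on P r) ->
  forall r s, a <= r -> r < s -> s <= b -> P r s.
Proof.
  intros Ht Hl r s Hr Hrs Hs.
  destruct (completeness (fun v => r <= v <= s /\ (r < v -> P r v))) as [m [Hm1 Hm2]].
  - exists s. intros v Hv. lra.
  - exists r. split; intros; lra.
  - assert (Hrm : r <= m) by (apply Hm1; split; intros; lra).
    assert (Hms : m <= s) by (apply Hm2; intros v Hv; lra).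
    destruct (Hl m) as [d [Hd HP]]; [lra|].
    assert (Hv : exists v, m - d < v <= m /\ r <= v /\ (r < v -> P r v)).
    { apply NNPP. intros Hn. assert (m <= m - d); [|lra].
      apply Hm2. intros v Hv. destruct (Rle_lt_dec v (m - d)) as [H|H]; auto.
      exfalso. apply Hn. exists v.
      assert (v <= m) by (apply Hm1; exact Hv). tauto. }
    destruct Hv as (v & Hvm & Hrv & HPv).
    assert (Hx : forall x, v < x < m + d -> P r x).
    { intros x Hx. destruct (Rle_lt_or_eq_dec r v Hrv) as [H|H].
      - apply (Ht r v x); try lra; auto. apply HP; lra.
      - rewrite H. apply HP; lra. }
    destruct (Rle_lt_or_eq_dec m s Hms) as [H|H].
    + pose proof (Rmin_l s (m + d / 2)). pose proof (Rmin_r s (m + d / 2)).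
      assert (m < Rmin s (m + d / 2)) by (apply Rmin_glb_lt; lra).
      assert (Rmin s (m + d / 2) <= m); [|lra].
      apply Hm1. split; [lra|]. intros _. apply Hx. lra.
    + subst m. destruct (Rle_lt_or_eq_dec v s) as [H|H]; [lra| |].
      * apply Hx. lra.
      * subst v. now apply HPv.
Qed.

Lemma sa_locally_on (P : R -> R -> R -> Prop) :
  sa (fun e => P (e O) (e (S O)) (e 2%nat)) ->
  sa (fun e => locally_on (P (e O)) (e (S O))).
Proof.
  intros HP. unfold locally_on. repeat sa_step.
  exact (sa_rename (fun i => match i with O => 3 | 1 => 1 | _ => O end)%nat _ HP).
Qed.

(** Applied separately for each [s], [tame_ramsey] would give intervals that may shrink with [s].
    Being local at a single [r] is a definable condition on [r] and [s], so [tame_uniform] can fix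
    one interval for all small [s]. *)
Lemma tame_ramsey_uniform (P : R -> R -> R -> Prop) a b : a < b ->
  sa (fun e => P (e O) (e (S O)) (e 2%nat)) ->
  exists d a' b', 0 < d /\ a < a' < b' /\ b' < b /\
    ((forall s r, 0 < s < d -> a' <= r <= b' -> locally_on (P s) r) \/
     (forall s r, 0 < s < d -> a' <= r <= b' -> locally_on (fun x y => ~ P s x y) r)).
Proof.
  intros Hab HP.
  set (Q := fun x y z => ~ P x y z).
  assert (HQ : sa (fun e => Q (e O) (e (S O)) (e 2%nat))) by now apply sa_not.
  assert (branch : forall T, sa (fun e => T (e O) (e (S O)) (e 2%nat)) ->
    forall a b, a < b ->
    (exists d a' b', 0 < d /\ a < a' < b' /\ b' < b /\
      forall s r, 0 < s < d -> a' <= r <= b' -> locally_on (T s) r) \/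
    (exists a' b', a < a' < b' /\ b' < b /\
      forall r, a' <= r <= b' -> ev (fun s => ~ locally_on (T s) r))).
  { clear a b Hab. intros T HT a b Hab.
    pose proof (sa_locally_on T HT) as HL.
    destruct (tame_interval (fun r => ev (fun s => locally_on (T s) r)) a b Hab)
      as (a' & b' & H1 & H2 & [H3|H3]).
    - apply sa_ev. exact HL.
    - left. destruct (tame_uniform (fun r s => locally_on (T s) r) a' b')
        as (d & c & c' & Hd & H4 & H5 & H6); try tauto.
      + exact (sa_swap (fun s r => locally_on (T s) r) HL).
      + intros r Hr. apply H3. lra.
      + exists d, c, c'. split; [auto|]. split; [lra|]. split; [lra|]. auto.
    - right. exists a', b'. split; [lra|]. split; [lra|].
      intros r Hr. apply not_ev_tame; auto.
      exact (sa_app2 (fun s r => locally_on (T s) r) _ _ HL (df_var 0) (df_const r)). }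
  destruct (branch P HP a b Hab) as [(d & a' & b' & H)|(a' & b' & H1 & H2 & H3)].
  { exists d, a', b'. intuition. }
  destruct (branch Q HQ a' b') as [(d & c & c' & H4 & H5 & H6 & H7)|(c & c' & H4 & H5 & H6)];
    [lra| |].
  { exists d, c, c'. split; [auto|]. split; [lra|]. split; [lra|]. right. exact H7. }
  (* Here, on some interval and for small [s], neither [P s] nor its negation holds locally at any
     point. Freezing [s] and applying [tame_ramsey] yields a subinterval where one of them holds,
     hence holds locally at the midpoint. *)
  exfalso.
  destruct (tame_uniform (fun r s => ~ locally_on (P s) r /\ ~ locally_on (Q s) r) c c')
    as (d & u & v & Hd & H7 & H8 & H9).
  - lra.
  - apply sa_and; apply sa_not.
    + exact (sa_swap (fun s r => locally_on (P s) r) (sa_locally_on P HP)).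
    + exact (sa_swap (fun s r => locally_on (Q s) r) (sa_locally_on Q HQ)).
  - intros r Hr. apply ev_and; [apply H3|apply H6]; lra.
  - destruct (tame_ramsey (P (d / 2)) u v) as (u' & v' & H10 & H11 & H12).
    + lra.
    + exact (sa_app3 P _ _ _ HP (df_const (d / 2)) (df_var 0) (df_var 1)).
    + destruct (H9 ((u' + v') / 2) (d / 2)) as [HnP HnQ]; [lra|lra|].
      destruct H12 as [H12|H12]; [apply HnP|apply HnQ];
        exists ((v' - u') / 2); (split; [lra|]); intros x y Hx Hxy Hy;
        apply H12; lra.
Qed.

(** * Growth estimates from one-sided slopes *)

(** Take the supremum of the points where the estimate holds. Monotonicity replaces continuity in
    showing that the estimate persists at the supremum: [h] can only jump upwards. *)
Lemma slope_lower (h : R -> R) a b c : a < b ->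
  (forall x y, a <= x -> x <= y -> y <= b -> h x <= h y) ->
  (forall x, a <= x < b -> ev (fun t => h x + c * t <= h (x + t))) ->
  h a + c * (b - a) <= h b.
Proof.
  intros Hab Hmono Hs.
  set (E := fun v => a <= v <= b /\ h a + c * (v - a) <= h v).
  assert (Ea : E a) by (split; lra).
  destruct (completeness E) as [m [Hm1 Hm2]].
  - exists b. intros v [Hv _]. lra.
  - now exists a.
  - assert (Ham : a <= m) by now apply Hm1.
    assert (Hmb : m <= b) by (apply Hm2; intros v [Hv _]; lra).
    assert (Em : E m).
    { split; [lra|]. destruct (Rle_lt_dec (h a + c * (m - a)) (h m)) as [H|H]; auto.
      exfalso. set (g := h a + c * (m - a) - h m) in *.
      (* [k] bounds [c] and is positive whatever the sign of [c], so the deficit [g] keeps all good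
         points at distance at least [g / k] below [m]. *)
      set (k := Rabs c + 1). assert (Hk : 0 < k) by (unfold k; pose proof (Rabs_pos c); lra).
      assert (Hgk : 0 < g / k) by (apply Rdiv_lt_0_compat; unfold g; lra).
      assert (m <= m - g / k); [|lra].
      apply Hm2. intros v [Hv1 Hv2].
      assert (Hvm : v <= m) by (apply Hm1; split; auto).
      assert (h v <= h m) by (apply Hmono; lra).
      assert (g <= c * (m - v)) by (unfold g; lra).
      assert (c * (m - v) <= k * (m - v)).
      { apply Rmult_le_compat_r; [lra|]. unfold k. pose proof (Rle_abs c). lra. }
      apply Rmult_le_reg_l with k; [auto|].
      replace (k * (m - g / k)) with (k * m - g) by (field; lra). lra. }
    destruct (Rle_lt_or_eq_dec m b Hmb) as [H|H]; [|subst m; apply Em].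
    exfalso. assert (Hd : 0 < b - m) by lra.
    destruct (ev_ex _ (ev_and _ _ (Hs m (conj Ham H)) (ev_lt _ Hd))) as [t [Ht [H1 H2]]].
    assert (m + t <= m); [|lra].
    apply Hm1. split; [lra|]. destruct Em. nra.
Qed.

Lemma slope_lower_left (h : R -> R) a b c : a < b ->
  (forall x y, a <= x -> x <= y -> y <= b -> h x <= h y) ->
  (forall x, a < x <= b -> ev (fun t => h (x - t) + c * t <= h x)) ->
  h a + c * (b - a) <= h b.
Proof.
  intros Hab Hmono Hs.
  pose proof (slope_lower (fun x => - h (- x)) (- b) (- a) c) as H.
  cbv beta in H. rewrite !Ropp_involutive in H.
  assert (- h b + c * (- a - - b) <= - h a); [apply H|]; try lra.
  - intros x y H1 H2 H3. apply Ropp_le_contravar, Hmono; lra.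
  - intros x Hx. refine (ev_imp _ _ _ (Hs (- x) _)); [|lra].
    intros t Ht H1. replace (- (x + t)) with (- x - t) by ring. lra.
Qed.

(** For an upper estimate the danger is an upward jump on arrival at a point, which the
    semicontinuity hypothesis from the left rules out. It will come from [robust_reg_lsc] along
    segments. *)
Lemma slope_upper (h : R -> R) a b c : a < b ->
  (forall x e, a < x <= b -> 0 < e -> ev (fun t => h x - e <= h (x - t))) ->
  (forall x, a <= x < b -> ev (fun t => h (x + t) <= h x + c * t)) ->
  h b <= h a + c * (b - a).
Proof.
  intros Hab Hlsc Hs.
  set (E := fun v => a <= v <= b /\ forall w, a <= w <= v -> h w <= h a + c * (w - a)).
  assert (Ea : E a).
  { split; [lra|]. intros w Hw. replace w with a by lra. lra. }
  destruct (completeness E) as [m [Hm1 Hm2]].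
  - exists b. intros v [Hv _]. lra.
  - now exists a.
  - assert (Ham : a <= m) by now apply Hm1.
    assert (Hmb : m <= b) by (apply Hm2; intros v [Hv _]; lra).
    assert (Hlt : forall w, a <= w < m -> h w <= h a + c * (w - a)).
    { intros w Hw. destruct (Rle_lt_dec (h w) (h a + c * (w - a))) as [H|H]; auto.
      exfalso. assert (m <= w); [|lra].
      apply Hm2. intros v [Hv1 Hv2]. destruct (Rle_lt_dec v w) as [H'|H']; auto.
      specialize (Hv2 w). lra. }
    assert (Hm : h m <= h a + c * (m - a)).
    { destruct (Rle_lt_or_eq_dec a m Ham) as [H|H]; [|subst m; lra].
      apply Rnot_lt_le. intros Hg.
      set (g := h m - (h a + c * (m - a))) in *.
      assert (Hg2 : 0 < g / 2) by (unfold g; lra).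
      assert (Hg3 : 0 < g / (2 * (Rabs c + 1))).
      { apply Rdiv_lt_0_compat; [unfold g|pose proof (Rabs_pos c)]; lra. }
      assert (Ham' : 0 < m - a) by lra.
      destruct (ev_ex _ (ev_and _ _ (Hlsc m (g / 2) (conj H Hmb) Hg2)
        (ev_and _ _ (ev_lt _ Ham') (ev_lt _ Hg3)))) as [t [Ht [H1 [H2 H3]]]].
      assert (h (m - t) <= h a + c * (m - t - a)) by (apply Hlt; lra).
      assert (t * (Rabs c + 1) < g / 2).
      { pose proof (Rabs_pos c). apply (Rmult_lt_compat_r (Rabs c + 1)) in H3; [|lra].
        replace (g / (2 * (Rabs c + 1)) * (Rabs c + 1)) with (g / 2) in H3 by (field; lra).
        exact H3. }
      assert (- c * t <= Rabs c * t).
      { apply Rmult_le_compat_r; [lra|]. rewrite <- Rabs_Ropp. apply Rle_abs. }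
      unfold g in *. lra. }
    assert (Em : E m).
    { split; [lra|]. intros w Hw. destruct (Rle_lt_or_eq_dec w m) as [H|H]; [lra| |].
      - apply Hlt. lra.
      - now subst w. }
    destruct (Rle_lt_or_eq_dec m b Hmb) as [H|H]; [|subst m; exact Hm].
    exfalso. destruct (Hs m (conj Ham H)) as [d [Hd Hdt]].
    pose proof (Rmin_l d (b - m)). pose proof (Rmin_r d (b - m)).
    assert (0 < Rmin d (b - m)) by (apply Rmin_glb_lt; lra).
    assert (m + Rmin d (b - m) / 2 <= m); [|lra].
    apply Hm1. split; [lra|]. intros w Hw.
    destruct (Rle_lt_dec w m) as [H3|H3]; [apply Em; lra|].
    specialize (Hdt (w - m)). replace (m + (w - m)) with w in Hdt by ring.
    assert (h w <= h m + c * (w - m)) by (apply Hdt; lra). lra.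
Qed.

(** * Definable Lipschitz selections *)

Lemma Rabs_le_bounds x a : Rabs x <= a -> - a <= x <= a.
Proof. unfold Rabs. destruct (Rcase_abs x); lra. Qed.

(** If the increments of [xi] locally exceeded slope [th] on a fixed interval, they would do so
    globally and [xi] would travel [th] times its length, while closeness to [z] allows only
    [2 * s]. The dichotomy leaves the reverse inequality; [k] runs over the two signs to bound the
    absolute value. *)
Lemma tame_lipschitz (xi : R -> R -> R) z a b s0 th :
  df (fun e => xi (e O) (e (S O))) -> a < b -> 0 < s0 -> 0 < th ->
  (forall r s, a < r < b -> 0 < s < s0 -> Rabs (xi r s - z) <= s) ->
  exists d a' b', 0 < d /\ a < a' < b' /\ b' < b /\
    forall s x y, 0 < s < d -> a' <= x -> x < y -> y <= b' ->
      Rabs (xi y s - xi x s) <= th * (y - x).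
Proof.
  intros Hxi Hab Hs0 Hth Hz.
  assert (key : forall k, k = 1 \/ k = -1 -> forall a b, a < b ->
    (forall r s, a < r < b -> 0 < s < s0 -> Rabs (xi r s - z) <= s) ->
    exists d a' b', 0 < d /\ a < a' < b' /\ b' < b /\
      forall s x y, 0 < s < d -> a' <= x -> x < y -> y <= b' ->
        k * (xi y s - xi x s) <= th * (y - x)).
  { clear a b Hab Hz. intros k Hk a b Hab Hz.
    set (P := fun s x y => th * (y - x) < k * (xi y s - xi x s)).
    destruct (tame_ramsey_uniform P a b Hab) as (d & a' & b' & Hd & H1 & H2 & [H3|H3]).
    - apply sa_lt; repeat sa_step; apply (df_app2 xi); auto; repeat sa_step.
    (* With this choice [2 * s] is at most half of the forced increment [th * (b' - a')]. *)
    - exfalso. set (s := Rmin (Rmin d s0) (th * (b' - a') / 2) / 2).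
      assert (Hp : 0 < th * (b' - a')) by (apply Rmult_lt_0_compat; lra).
      pose proof (Rmin_l (Rmin d s0) (th * (b' - a') / 2)).
      pose proof (Rmin_r (Rmin d s0) (th * (b' - a') / 2)).
      pose proof (Rmin_l d s0). pose proof (Rmin_r d s0).
      assert (0 < Rmin (Rmin d s0) (th * (b' - a') / 2)).
      { repeat apply Rmin_glb_lt; lra. }
      assert (HP : P s a' b').
      { apply (local_to_global (P s) a' b'); try lra.
        - unfold P. intros x y w _ _ Hxy Hyw. lra.
        - intros r Hr. apply H3; [unfold s; lra|auto]. }
      unfold P in HP.
      assert (Hs : 0 < s < s0) by (unfold s; lra).
      pose proof (Hz a' s ltac:(lra) Hs) as Ha. pose proof (Hz b' s ltac:(lra) Hs) as Hb.
      apply Rabs_le_bounds in Ha. apply Rabs_le_bounds in Hb.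
      assert (2 * s <= th * (b' - a') / 2) by (unfold s; lra).
      destruct Hk; subst k; lra.
    - exists d, a', b'. split; [auto|]. split; [lra|]. split; [lra|].
      intros s x y Hs Hx Hxy Hy. apply Rnot_lt_le.
      apply (local_to_global (fun x y => ~ P s x y) a' b'); auto.
      unfold P. intros u v w _ _ Huv Hvw. lra. }
  destruct (key 1 (or_introl eq_refl) a b Hab Hz) as (d & a' & b' & Hd & H1 & H2 & H3).
  destruct (key (-1) (or_intror eq_refl) a' b') as (d' & c & c' & Hd' & H4 & H5 & H6).
  - lra.
  - intros r s Hr Hs. apply Hz; lra.
  - exists (Rmin d d'), c, c'. pose proof (Rmin_l d d'). pose proof (Rmin_r d d').
    split; [now apply Rmin_glb_lt|]. split; [lra|]. split; [lra|].
    intros s x y Hs Hx Hxy Hy. apply Rabs_le.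
    specialize (H3 s x y). specialize (H6 s x y). lra.
Qed.

(* The least element when there is one, and otherwise the midpoint of the
   first interval. *)
Definition picked (D : R -> Prop) (v : R) : Prop :=
  exists a, (forall x, D x -> a <= x) /\ (forall b, (forall x, D x -> b <= x) -> b <= a) /\
    ((D a /\ v = a) \/
     (~ D a /\ exists b, is_lub (fun u => a < u /\ forall x, a < x -> x < u -> D x) b /\
        2 * v = a + b)).

Lemma picked_unique D v w : picked D v -> picked D w -> v = w.
Proof.
  intros (a & H1 & H2 & H3) (a' & H1' & H2' & H3').
  assert (a = a') by (apply Rle_antisym; auto). subst a'.
  destruct H3 as [[Ha ->]|[Ha (b & Hb & Hv)]];
    destruct H3' as [[Ha' ->]|[Ha' (b' & Hb' & Hw)]]; try tauto.
  assert (b = b') by (eapply is_lub_eq; eauto). lra.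
Qed.

(** When the infimum [a] is not attained, tameness makes [D] hold just to the right of [a];
    otherwise a larger lower bound would exist. Boundedness of [D] keeps the end [b] of this
    interval finite, and an interval of [D] reaching past the midpoint exists because [b] is a
    supremum. *)
Lemma picked_exists D M :
  sa (fun e => D (e O)) -> (exists x, D x) -> (forall x, D x -> Rabs x <= M) ->
  exists v, picked D v /\ D v.
Proof.
  intros HD [x0 Hx0] HM.
  destruct (completeness (fun y => D (- y))) as [m [Hm1 Hm2]].
  - exists M. intros y Hy. apply HM, Rabs_le_bounds in Hy. lra.
  - exists (- x0). now rewrite Ropp_involutive.
  - assert (Ha1 : forall x, D x -> - m <= x).
    { intros x Hx. assert (- x <= m); [|lra]. apply Hm1. now rewrite Ropp_involutive. }
    assert (Ha2 : forall b, (forall x, D x -> b <= x) -> b <= - m).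
    { intros b Hb. assert (m <= - b); [|lra]. apply Hm2. intros y Hy.
      apply Hb in Hy. lra. }
    set (a := - m) in *.
    destruct (classic (D a)) as [Ha|Ha].
    { exists a. split; auto. exists a. tauto. }
    set (E := fun u => a < u /\ forall x, a < x -> x < u -> D x).
    destruct (completeness E) as [b Hb].
    + exists M. intros u [Hu1 Hu2]. apply Rnot_lt_le. intros Hlt.
      set (x := (Rmax a M + u) / 2).
      assert (Rmax a M < u) by (now apply Rmax_lub_lt).
      pose proof (Rmax_l a M). pose proof (Rmax_r a M).
      assert (Hx : D x) by (apply Hu2; unfold x; lra).
      apply HM, Rabs_le_bounds in Hx. unfold x in Hx. lra.
    + destruct (tame D a HD) as [[d [Hd H]]|[d [Hd H]]].
      * exists (a + d). split; [lra|]. intros x H1 H2.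
        replace x with (a + (x - a)) by ring. apply H. lra.
      * exfalso. assert (a + d <= a); [|lra]. apply Ha2. intros x Hx.
        apply Rnot_lt_le. intros Hlt.
        destruct (Rle_lt_or_eq_dec a x (Ha1 x Hx)) as [Hax|Hax].
        -- apply (H (x - a)); [lra|]. now replace (a + (x - a)) with x by ring.
        -- subst x. tauto.
    + exists ((a + b) / 2). split.
      * exists a. split; [auto|]. split; [auto|]. right. split; [auto|].
        exists b. split; [exact Hb|lra].
      * destruct Hb as [Hb1 Hb2].
        assert (Hu : exists u, E u /\ (a + b) / 2 < u).
        { apply NNPP. intros Hn.
          assert (Hba : b <= (a + b) / 2).
          { apply Hb2. intros u Hu. apply Rnot_lt_le. intros Hlt. apply Hn. now exists u. }
          destruct (tame D a HD) as [[d [Hd H]]|[d [Hd H]]].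
          - assert (a + d <= b); [|lra]. apply Hb1. split; [lra|]. intros x H1 H2.
            replace x with (a + (x - a)) by ring. apply H. lra.
          - assert (a + d <= a); [|lra]. apply Ha2. intros x Hx.
            apply Rnot_lt_le. intros Hlt.
            destruct (Rle_lt_or_eq_dec a x (Ha1 x Hx)) as [Hax|Hax].
            + apply (H (x - a)); [lra|]. now replace (a + (x - a)) with x by ring.
            + subst x. tauto. }
        destruct Hu as [u [[Hu1 Hu2] Hu3]].
        assert (u <= b) by (apply Hb1; now split). apply Hu2; lra.
Qed.

Lemma definable_choice (D : R -> R -> R -> Prop) :
  sa (fun e => D (e O) (e (S O)) (e 2%nat)) ->
  exists c : R -> R -> R, df (fun e => c (e O) (e (S O))) /\
    forall r s M, (exists x, D r s x) -> (forall x, D r s x -> Rabs x <= M) ->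
      D r s (c r s).
Proof.
  intros HD. exists (fun r s => epsilon (inhabits 0) (picked (D r s))). split.
  - apply (df_epsilon (fun e => picked (D (e O) (e (S O))))).
    + intros e. apply picked_unique.
    + unfold picked, is_lub, is_upper_bound.
      repeat (sa_step || (apply (sa_app3 D); [exact HD| | |])).
  - intros r s M Hx HM.
    destruct (picked_exists (D r s) M) as [v [Hv Dv]]; auto.
    + apply (sa_app3 D); auto using df_const, df_var.
    + assert (H : picked (D r s) (epsilon (inhabits 0) (picked (D r s)))).
      { apply epsilon_spec. now exists v. }
      now rewrite (picked_unique _ _ _ H Hv).
Qed.

(** Coordinates are selected one after another, each by definable choice among the values compatible
    with those already fixed. Making the new coordinate Lipschitz shrinks the interval, which
    preserves the estimates for the old ones. *)
Lemma lipschitz_selection {n} (A : R -> R -> vec n -> Prop) (z : vec n) a b s0 th :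
  (forall u v X, df u -> df v -> vdf X -> sa (fun e => A (u e) (v e) (X e))) ->
  a < b -> 0 < s0 -> 0 < th ->
  (forall r s, a < r < b -> 0 < s < s0 -> exists x, A r s x) ->
  (forall r s x, A r s x -> forall i, (i < n)%nat -> Rabs (vc x i - vc z i) <= s) ->
  exists d a' b', 0 < d /\ a < a' < b' /\ b' < b /\
    forall s, 0 < s < d -> exists x : R -> vec n,
      (forall r, a' <= r <= b' -> A r s (x r)) /\
      forall r1 r2, a' <= r1 -> r1 < r2 -> r2 <= b' ->
        forall i, (i < n)%nat -> Rabs (vc (x r2) i - vc (x r1) i) <= th * (r2 - r1).
Proof.
  intros HA Hab Hs0 Hth Hex Hz.
  assert (ind : forall k, (k <= n)%nat -> exists (xi : nat -> R -> R -> R) d a' b',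
    (forall i, (i < k)%nat -> df (fun e => xi i (e O) (e (S O)))) /\
    0 < d <= s0 /\ a <= a' /\ a' < b' /\ b' <= b /\
    (forall r s, a' < r < b' -> 0 < s < d ->
       exists x, A r s x /\ forall i, (i < k)%nat -> vc x i = xi i r s) /\
    (forall i s x y, (i < k)%nat -> 0 < s < d -> a' < x -> x < y -> y < b' ->
       Rabs (xi i y s - xi i x s) <= th * (y - x))).
  { intros k. induction k as [|k IH]; intros Hk.
    - exists (fun _ _ _ => 0), s0, a, b.
      split; [intros; lia|]. split; [lra|]. split; [lra|]. split; [lra|]. split; [lra|].
      split; [|intros; lia].
      intros r s Hr Hs. destruct (Hex r s Hr Hs) as [x Hx]. exists x. split; [auto|].
      intros; lia.
    - destruct IH as (xi & d & a' & b' & Hdf & Hd & H1 & H2 & H3 & H4 & H5); [lia|].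
      set (D := fun r s t => exists x, A r s x /\
        (forall i, (i < k)%nat -> vc x i = xi i r s) /\ t = vc x k).
      assert (HD : sa (fun e => D (e O) (e (S O)) (e 2%nat))).
      { unfold D. apply sa_ex_vec. apply sa_and; [apply HA; repeat sa_step|].
        apply sa_and.
        - apply sa_forall_lt. intros i Hi. apply sa_eq.
          + apply (vdf_mkvec n (fun j => j)). lia.
          + apply (df_app2 (xi i)); auto; repeat sa_step.
        - apply sa_eq; [repeat sa_step|].
          apply (vdf_mkvec n (fun j => j)). lia. }
      destruct (definable_choice D HD) as (c & Hc & HDc).
      assert (Hc' : forall r s, a' < r < b' -> 0 < s < d -> D r s (c r s)).
      { intros r s Hr Hs. apply (HDc r s (Rabs (vc z k) + s)).
        - destruct (H4 r s Hr Hs) as [x [Hx1 Hx2]]. exists (vc x k), x. auto.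
        - intros t [x [Hx1 [Hx2 ->]]].
          replace (vc x k) with (vc z k + (vc x k - vc z k)) by ring.
          eapply Rle_trans; [apply Rabs_triang|].
          apply Rplus_le_compat_l. apply (Hz r s x Hx1). lia. }
      destruct (tame_lipschitz c (vc z k) a' b' d th) as (d' & u & v & Hd' & H6 & H7 & H8);
        try tauto; try lra.
      { intros r s Hr Hs. destruct (Hc' r s Hr Hs) as [x [Hx1 [Hx2 ->]]].
        apply (Hz r s x Hx1). lia. }
      exists (fun i => if Nat.eqb i k then c else xi i), (Rmin d d'), u, v.
      pose proof (Rmin_l d d'). pose proof (Rmin_r d d').
      assert (0 < Rmin d d') by (apply Rmin_glb_lt; lra).
      split; [|split; [lra|split; [lra|split; [lra|split; [lra|split]]]]].
      + intros i Hi. destruct (Nat.eqb_spec i k); [exact Hc|apply Hdf; lia].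
      + intros r s Hr Hs. destruct (Hc' r s) as [x [Hx1 [Hx2 Hx3]]]; try lra.
        exists x. split; [auto|]. intros i Hi.
        destruct (Nat.eqb_spec i k) as [->|]; [auto|apply Hx2; lia].
      + intros i s x y Hi Hs Hx Hxy Hy. destruct (Nat.eqb_spec i k) as [->|].
        * apply H8; lra.
        * apply H5; try lra. lia. }
  destruct (ind n (le_n n)) as (xi & d & a' & b' & Hdf & Hd & H1 & H2 & H3 & H4 & H5).
  (* The induction works on an open interval; its closed middle third lies inside. *)
  exists d, ((2 * a' + b') / 3), ((a' + 2 * b') / 3).
  split; [lra|]. split; [lra|]. split; [lra|].
  intros s Hs. exists (fun r => mkvec n (fun i => xi i r s)). split.
  - intros r Hr. destruct (H4 r s) as [x [Hx1 Hx2]]; try lra.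
    replace (mkvec n (fun i => xi i r s)) with x; auto.
    apply vec_ext. intros i Hi. rewrite vc_mkvec; auto.
  - intros r1 r2 Hr1 Hr Hr2 i Hi. rewrite !vc_mkvec by auto. apply H5; auto; lra.
Qed.

(** * Euclidean distance and the robust regularization *)

Lemma sumR_ext k a b : (forall i, (i < k)%nat -> a i = b i) -> sumR k a = sumR k b.
Proof.
  induction k as [|k IH]; intros H; simpl; auto. rewrite IH, H; auto.
Qed.

Lemma sumR_sq_pos k a : 0 <= sumR k (fun i => a i ^ 2).
Proof. induction k as [|k IH]; simpl in *; [lra|]. nra. Qed.

Lemma sumR_scal k c a : sumR k (fun i => c * a i) = c * sumR k a.
Proof. induction k as [|k IH]; simpl; [ring|]. rewrite IH. ring. Qed.

(** The planar case, with [A] and [B] standing for the norms of the coordinates already treated in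
    [minkowski]. Cauchy-Schwarz comes from the square of [A * b - a * B]. *)
Lemma minkowski2 A B a b : 0 <= A -> 0 <= B ->
  sqrt ((A + B) ^ 2 + (a + b) ^ 2) <= sqrt (A ^ 2 + a ^ 2) + sqrt (B ^ 2 + b ^ 2).
Proof.
  intros HA HB.
  set (P := sqrt (A ^ 2 + a ^ 2)). set (Q := sqrt (B ^ 2 + b ^ 2)).
  assert (HP : P * P = A ^ 2 + a ^ 2) by (apply sqrt_sqrt; nra).
  assert (HQ : Q * Q = B ^ 2 + b ^ 2) by (apply sqrt_sqrt; nra).
  assert (P0 : 0 <= P) by apply sqrt_pos. assert (Q0 : 0 <= Q) by apply sqrt_pos.
  assert (H : A * B + a * b <= P * Q).
  { apply Rsqr_incr_0_var; [unfold Rsqr|nra].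
    replace (P * Q * (P * Q)) with ((P * P) * (Q * Q)) by ring. rewrite HP, HQ.
    pose proof (Rle_0_sqr (A * b - a * B)) as H. unfold Rsqr in H. nra. }
  rewrite <- (sqrt_square (P + Q)) by lra. apply sqrt_le_1_alt. nra.
Qed.

Lemma minkowski k a b :
  sqrt (sumR k (fun i => (a i + b i) ^ 2)) <=
  sqrt (sumR k (fun i => a i ^ 2)) + sqrt (sumR k (fun i => b i ^ 2)).
Proof.
  induction k as [|k IH]; cbn [sumR].
  - rewrite sqrt_0. lra.
  - set (A := sqrt (sumR k (fun i => a i ^ 2))) in *.
    set (B := sqrt (sumR k (fun i => b i ^ 2))) in *.
    assert (HA : sumR k (fun i => a i ^ 2) = A ^ 2)
      by (unfold A; rewrite pow2_sqrt; auto using sumR_sq_pos).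
    assert (HB : sumR k (fun i => b i ^ 2) = B ^ 2)
      by (unfold B; rewrite pow2_sqrt; auto using sumR_sq_pos).
    assert (HS : sumR k (fun i => (a i + b i) ^ 2) <= (A + B) ^ 2).
    { rewrite <- (pow2_sqrt (sumR k _)) by apply (sumR_sq_pos k (fun i => a i + b i)).
      apply pow_incr. split; [apply sqrt_pos|exact IH]. }
    rewrite HA, HB. eapply Rle_trans; [|apply minkowski2; apply sqrt_pos].
    apply sqrt_le_1_alt. fold A B. lra.
Qed.

Lemma dist_pos {n} (x y : vec n) : 0 <= dist x y.
Proof. apply sqrt_pos. Qed.

Lemma dist_sym {n} (x y : vec n) : dist x y = dist y x.
Proof. unfold dist. f_equal. apply sumR_ext. intros i _. ring. Qed.

Lemma dist_refl {n} (x : vec n) : dist x x = 0.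
Proof.
  unfold dist. rewrite <- sqrt_0. f_equal.
  assert (H : forall k, sumR k (fun i => (vc x i - vc x i) ^ 2) = 0).
  { intros k. induction k as [|k IHk]; cbn [sumR]; [auto|rewrite IHk; ring]. }
  apply H.
Qed.

Lemma dist_triangle {n} (x y z : vec n) : dist x z <= dist x y + dist y z.
Proof.
  unfold dist. eapply Rle_trans; [|apply minkowski].
  apply Req_le. f_equal. apply sumR_ext. intros i _. ring.
Qed.

Lemma dist_coord {n} (x y : vec n) i : (i < n)%nat -> Rabs (vc x i - vc y i) <= dist x y.
Proof.
  intros Hi. unfold dist. rewrite <- sqrt_Rsqr_abs. apply sqrt_le_1_alt.
  set (a := fun i => vc x i - vc y i). change (Rsqr (a i) <= sumR n (fun i => a i ^ 2)).
  generalize n Hi. clear. intros k Hi. induction k as [|k IH]; [lia|]. cbn [sumR].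
  pose proof (sumR_sq_pos k a). pose proof (pow2_ge_0 (a k)).
  destruct (Nat.eq_dec i k) as [->|Hne].
  - unfold Rsqr. lra.
  - assert (Rsqr (a i) <= sumR k (fun i => a i ^ 2)) by (apply IH; lia). lra.
Qed.

Lemma dist_le_coords {n} (x y : vec n) c :
  (forall i, (i < n)%nat -> Rabs (vc x i - vc y i) <= c) -> dist x y <= INR n * c.
Proof.
  unfold dist. set (a := fun i => vc x i - vc y i). intros H.
  change (sqrt (sumR n (fun i => a i ^ 2)) <= INR n * c).
  assert (Ha : forall i, (i < n)%nat -> Rabs (a i) <= c) by exact H. clear H.
  clearbody a. clear x y. induction n as [|k IH]; cbn [sumR].
  - rewrite sqrt_0. simpl. lra.
  - rewrite S_INR.
    assert (H1 : sqrt (sumR k (fun i => a i ^ 2)) <= INR k * c) by (apply IH; auto).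
    pose proof (minkowski2 (sqrt (sumR k (fun i => a i ^ 2))) 0 0 (a k)
      (sqrt_pos _) (Rle_refl 0)) as H2.
    rewrite Rplus_0_r, pow2_sqrt, Rplus_0_l in H2 by apply sumR_sq_pos.
    replace (sumR k (fun i => a i ^ 2) + 0 ^ 2) with (sumR k (fun i => a i ^ 2)) in H2 by ring.
    replace (0 ^ 2 + a k ^ 2) with (Rsqr (a k)) in H2 by (unfold Rsqr; ring).
    rewrite sqrt_Rsqr_abs in H2. specialize (Ha k ltac:(lia)). lra.
Qed.

Definition line {n} (x y : vec n) (t : R) : vec n :=
  mkvec n (fun i => vc x i + t * (vc y i - vc x i)).

Lemma line_0 {n} (x y : vec n) : line x y 0 = x.
Proof. apply vec_ext. intros i Hi. unfold line. rewrite vc_mkvec by auto. ring. Qed.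

Lemma line_1 {n} (x y : vec n) : line x y 1 = y.
Proof. apply vec_ext. intros i Hi. unfold line. rewrite vc_mkvec by auto. ring. Qed.

Lemma dist_line {n} (x y : vec n) s t : dist (line x y s) (line x y t) = Rabs (s - t) * dist x y.
Proof.
  unfold dist. rewrite <- sqrt_Rsqr_abs, <- sqrt_mult by (apply Rle_0_sqr || apply sumR_sq_pos).
  f_equal. rewrite <- sumR_scal. apply sumR_ext. intros i Hi.
  unfold line. rewrite !vc_mkvec by auto. unfold Rsqr. ring.
Qed.

Lemma dist_line_0 {n} (x y : vec n) t : 0 <= t -> dist (line x y t) x = t * dist x y.
Proof.
  intros Ht. rewrite <- (line_0 x y) at 2. rewrite dist_line, Rminus_0_r, Rabs_pos_eq; auto.
Qed.

Lemma dist_line_1 {n} (x y : vec n) t : t <= 1 -> dist (line x y t) y = (1 - t) * dist x y.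
Proof.
  intros Ht. rewrite <- (line_1 x y) at 2.
  rewrite dist_line, Rabs_minus_sym, Rabs_pos_eq by lra. reflexivity.
Qed.

Lemma exists_at_distance {n} (hn : (1 <= n)%nat) (z : vec n) t :
  0 < t -> exists x, dist x z = t.
Proof.
  intros Ht. set (y := mkvec n (fun i => vc z i + 1)).
  assert (Hy : 0 < dist z y).
  { apply Rlt_le_trans with (Rabs (vc z 0 - vc y 0)); [|apply dist_coord; lia].
    unfold y. rewrite vc_mkvec by lia. apply Rabs_pos_lt. lra. }
  exists (line z y (t / dist z y)). rewrite dist_line_0.
  - field. lra.
  - apply Rlt_le, Rdiv_lt_0_compat; auto.
Qed.

(** Compactness of a cube by a tube argument. The first [j] coordinates stay near those of [x], the
    others range over the cube. [P u v] is boundedness over the slab where coordinate [j] lies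
    between [u] and [v]: it is transitive, and local by the induction hypothesis. *)
Lemma continuous_bounded {n} (f : vec n -> R) (z : vec n) r :
  continuous_vec f -> exists M, forall y, dist y z <= r -> f y <= M.
Proof.
  (* The maximum with 1 keeps the sides of the cube nondegenerate, as [local_to_global] requires. *)
  intros Hf. set (b := Rmax 1 r).
  assert (Hb : 1 <= b /\ r <= b) by (split; [apply Rmax_l|apply Rmax_r]).
  assert (ind : forall k j, (j + k)%nat = n -> forall x : vec n, exists d M, 0 < d /\
    forall y : vec n, (forall i, (i < j)%nat -> Rabs (vc y i - vc x i) < d) ->
      (forall i, (j <= i)%nat -> (i < n)%nat -> Rabs (vc y i - vc z i) <= b) -> f y <= M).
  { induction k as [|k IH]; intros j Hj x.
    - destruct (Hf x 1 Rlt_0_1) as [d [Hd H]].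
      set (c := d / (INR n + 1)).
      assert (Hn : 0 < INR n + 1) by (pose proof (pos_INR n); lra).
      assert (Hc : 0 < c) by now apply Rdiv_lt_0_compat.
      exists c, (f x + 1). split; [exact Hc|]. intros y Hy _.
      assert (Hyx : dist y x < d).
      { apply Rle_lt_trans with (INR n * c).
        - apply dist_le_coords. intros i Hi. apply Rlt_le, Hy. lia.
        - assert (d = INR n * c + c) by (unfold c; field; lra). lra. }
      specialize (H y Hyx). apply Rabs_def2 in H. lra.
    - set (P := fun u v => exists d M, 0 < d /\ forall y : vec n,
        (forall i, (i < j)%nat -> Rabs (vc y i - vc x i) < d) -> u <= vc y j <= v ->
        (forall i, (S j <= i)%nat -> (i < n)%nat -> Rabs (vc y i - vc z i) <= b) -> f y <= M).
      assert (HP : P (vc z j - b) (vc z j + b)).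
      { apply (local_to_global P (vc z j - b) (vc z j + b)); try lra.
        - intros u v w _ _ (d & M & Hd & H) (d' & M' & Hd' & H').
          exists (Rmin d d'), (Rmax M M'). split; [now apply Rmin_glb_lt|].
          intros y Hy1 Hy2 Hy3.
          pose proof (Rmin_l d d'). pose proof (Rmin_r d d').
          pose proof (Rmax_l M M'). pose proof (Rmax_r M M').
          destruct (Rle_lt_dec (vc y j) v).
          + apply Rle_trans with M; [apply H|]; auto; [|lra].
            intros i Hi. apply Rlt_le_trans with (Rmin d d'); auto.
          + apply Rle_trans with M'; [apply H'|]; auto; [|lra].
            intros i Hi. apply Rlt_le_trans with (Rmin d d'); auto.
        - intros v _.
          destruct (IH (S j) ltac:(lia) (mkvec n (fun i => if Nat.eqb i j then v else vc x i)))
            as (d & M & Hd & H).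
          exists d. split; [auto|]. intros u w Hu Huw Hw. exists d, M. split; [auto|].
          intros y Hy1 Hy2 Hy3. apply H; auto. intros i Hi. rewrite vc_mkvec by lia.
          destruct (Nat.eqb_spec i j) as [->|]; [apply Rabs_def1; lra|apply Hy1; lia]. }
      destruct HP as (d & M & Hd & H). exists d, M. split; [auto|].
      intros y Hy1 Hy2. apply H; auto.
      + specialize (Hy2 j ltac:(lia) ltac:(lia)). apply Rabs_le_bounds in Hy2. lra.
      + intros i Hi Hi'. apply Hy2; lia. }
  destruct (ind n O ltac:(lia) z) as (d & M & _ & H). exists M.
  intros y Hy. apply H; [intros; lia|]. intros i _ Hi.
  apply Rle_trans with (dist y z); [now apply dist_coord|lra].
Qed.

Section RobustRegularization.
Context {n : nat} (hn : (1 <= n)%nat) (f : vec n -> R) (hcont : continuous_vec f).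

Lemma robust_reg_lub r x : 0 <= r ->
  is_lub (fun v => exists x', dist x' x <= r /\ v = f x') (robust_reg f r x).
Proof.
  intros Hr. unfold robust_reg, supR. apply epsilon_spec.
  destruct (continuous_bounded f x r hcont) as [M HM].
  destruct (completeness (fun v => exists x', dist x' x <= r /\ v = f x')) as [m Hm].
  - exists M. intros v [y [Hy ->]]. auto.
  - exists (f x), x. rewrite dist_refl. auto.
  - now exists m.
Qed.

Lemma robust_reg_ub r x y : dist y x <= r -> f y <= robust_reg f r x.
Proof.
  intros H. apply (robust_reg_lub r x); [|now exists y].
  pose proof (dist_pos y x). lra.
Qed.

Lemma robust_reg_le r x M : 0 <= r ->
  (forall y, dist y x <= r -> f y <= M) -> robust_reg f r x <= M.
Proof.
  intros Hr H. apply (robust_reg_lub r x Hr). intros v [y [Hy ->]]. auto.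
Qed.

Lemma robust_reg_mono r x r' x' : 0 <= r -> r + dist x x' <= r' ->
  robust_reg f r x <= robust_reg f r' x'.
Proof.
  intros Hr H. apply robust_reg_le; auto. intros y Hy. apply robust_reg_ub.
  pose proof (dist_triangle y x x'). lra.
Qed.

(** A nearly maximal point [y] of the ball around [x] is pulled towards [x'] just enough to enter
    the ball of the same radius around [x']; continuity at [y] controls the loss. *)
Lemma robust_reg_lsc r x e : 0 < r -> 0 < e ->
  exists d, 0 < d /\ forall x', dist x' x < d -> robust_reg f r x - e <= robust_reg f r x'.
Proof.
  intros Hr He.
  assert (Hy : exists y, dist y x <= r /\ robust_reg f r x - e / 2 < f y).
  { apply NNPP. intros Hn. assert (robust_reg f r x <= robust_reg f r x - e / 2); [|lra].
    apply robust_reg_le; [lra|]. intros y Hy. apply Rnot_lt_le. intros Hlt.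
    apply Hn. now exists y. }
  destruct Hy as [y [Hy1 Hy2]]. destruct (hcont y (e / 2)) as [d [Hd Hc]]; [lra|].
  exists d. split; [auto|]. intros x' Hx'.
  set (s := dist x' x) in *. assert (0 <= s) by apply dist_pos.
  (* [y] is within [r + s] of [x']. Contracting by [1 - t = r / (r + s)] brings it within [r], and
     it moves by at most [t * (r + s) = s]. *)
  set (t := s / (r + s)).
  assert (Ht : t * (r + s) = s) by (unfold t; field; lra).
  assert (Ht0 : 0 <= t) by (apply Rmult_le_pos; [auto|apply Rlt_le, Rinv_0_lt_compat; lra]).
  assert (Ht1 : t <= 1).
  { apply Rmult_le_reg_r with (r + s); [lra|]. lra. }
  assert (Hyx : dist y x' <= r + s).
  { pose proof (dist_triangle y x x'). unfold s. rewrite (dist_sym x' x). lra. }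
  assert (H1 : dist (line y x' t) x' <= r).
  { rewrite dist_line_1 by auto.
    apply Rle_trans with ((1 - t) * (r + s)); [apply Rmult_le_compat_l; lra|lra]. }
  assert (H2 : dist (line y x' t) y < d).
  { rewrite dist_line_0 by auto.
    apply Rle_lt_trans with (t * (r + s)); [apply Rmult_le_compat_l; lra|lra]. }
  specialize (Hc _ H2). apply Rabs_def2 in Hc.
  pose proof (robust_reg_ub r x' _ H1). lra.
Qed.

Lemma robust_reg_at_0 x e : 0 < e ->
  ev (fun r => f x <= robust_reg f r x <= f x + e).
Proof.
  intros He. destruct (hcont x e He) as [d [Hd H]]. exists d. split; [auto|].
  intros r Hr. split.
  - apply robust_reg_ub. rewrite dist_refl. lra.
  - apply robust_reg_le; [lra|]. intros y Hy.
    assert (Hyx : dist y x < d) by lra. specialize (H y Hyx). apply Rabs_def2 in H. lra.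
Qed.

End RobustRegularization.

(** * Calmness and Lipschitz moduli *)

Section Moduli.
Context {n : nat} (hn : (1 <= n)%nat) (f : vec n -> R) (hcont : continuous_vec f)
  (hsa : semialgebraic_fun f) (xb : vec n).
Notation G := (robust_reg f).
Notation g r := (robust_reg f r xb).

(** Bounds free of quotients and limits superior, hence visibly definable in [r] and [K]; the
    modulus is the infimum of such [K]. *)
Definition calm_le (r K : R) : Prop :=
  exists d, 0 < d /\ forall x, dist x xb < d -> Rabs (G r x - g r) <= K * dist x xb.

Definition lip_le (r K : R) : Prop :=
  exists d, 0 < d /\ forall x y, dist x xb < d -> dist y xb < d ->
    Rabs (G r x - G r y) <= K * dist x y.

Ltac sa_tac :=
  repeat (sa_step || (apply (df_robust_reg f); [exact hsa| | ]) ||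
    (apply (df_semialgebraic_fun f); [exact hsa|])).

Lemma sa_calm_le u v : df u -> df v -> sa (fun e => calm_le (u e) (v e)).
Proof. intros Hu Hv. unfold calm_le. sa_tac. Qed.

Lemma sa_lip_le u v : df u -> df v -> sa (fun e => lip_le (u e) (v e)).
Proof. intros Hu Hv. unfold lip_le. sa_tac. Qed.

Lemma calm_le_pos r K : calm_le r K -> 0 <= K.
Proof.
  intros [d [Hd H]]. destruct (exists_at_distance hn xb (d / 2)) as [x Hx]; [lra|].
  specialize (H x). rewrite Hx in H. pose proof (Rabs_pos (G r x - g r)).
  apply Rmult_le_reg_r with (d / 2); [lra|]. lra.
Qed.

Lemma calm_le_mono r K K' : K <= K' -> calm_le r K -> calm_le r K'.
Proof.
  intros HK [d [Hd H]]. exists d. split; [auto|]. intros x Hx.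
  specialize (H x Hx). pose proof (dist_pos x xb). nra.
Qed.

Lemma lip_le_mono r K K' : K <= K' -> lip_le r K -> lip_le r K'.
Proof.
  intros HK [d [Hd H]]. exists d. split; [auto|]. intros x y Hx Hy.
  specialize (H x y Hx Hy). pose proof (dist_pos x y). nra.
Qed.

Lemma g_mono r s : 0 <= r -> r <= s -> g r <= g s.
Proof. intros Hr Hrs. apply robust_reg_mono; auto. rewrite dist_refl. lra. Qed.

(** With [t] the distance from [x] to [xb], [G r x] is squeezed between [g (r - t)] and
    [g (r + t)]. *)
Lemma calm_le_of_slopes r K : 0 < r ->
  ev (fun t => g (r + t) <= g r + K * t) -> ev (fun t => g r <= g (r - t) + K * t) ->
  calm_le r K.
Proof.
  intros Hr H1 H2.
  destruct (ev_and _ _ H1 (ev_and _ _ H2 (ev_lt r Hr))) as [d [Hd H]].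
  exists d. split; [auto|]. intros x Hx. set (t := dist x xb) in *.
  destruct (Rle_lt_or_eq_dec 0 t (dist_pos x xb)) as [Ht|Ht].
  - destruct (H t (conj Ht Hx)) as [H3 [H4 H5]].
    assert (G r x <= g (r + t)) by (apply robust_reg_mono; auto; unfold t; lra).
    assert (g (r - t) <= G r x).
    { apply robust_reg_mono; auto; [lra|]. rewrite dist_sym. unfold t. lra. }
    apply Rabs_le. lra.
  - assert (G r x <= g r) by (apply robust_reg_mono; auto; unfold t in Ht; lra).
    assert (g r <= G r x).
    { apply robust_reg_mono; auto; [lra|]. rewrite dist_sym. unfold t in Ht. lra. }
    apply Rabs_le. rewrite <- Ht. lra.
Qed.

Lemma not_calm_le_slopes r K : 0 < r -> ~ calm_le r K ->
  ev (fun t => g r + K * t <= g (r + t)) \/ ev (fun t => g (r - t) + K * t <= g r).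
Proof.
  intros Hr Hn.
  destruct (ev_tame (fun t => g (r + t) <= g r + K * t)) as [H1|H1]; [sa_tac| |].
  - destruct (ev_tame (fun t => g r <= g (r - t) + K * t)) as [H2|H2]; [sa_tac| |].
    + exfalso. auto using calm_le_of_slopes.
    + right. revert H2. apply ev_imp. intros. lra.
  - left. revert H1. apply ev_imp. intros. lra.
Qed.

(** A converse to the right: every point [y] of the ball of radius [r + t] around [xb] is within [r]
    of a point of the segment from [xb] to [y] at distance at most [t] from [xb]. *)
Lemma slope_of_calm_le r K : 0 < r -> calm_le r K -> ev (fun t => g (r + t) <= g r + K * t).
Proof.
  intros Hr HK. pose proof (calm_le_pos r K HK) as K0.
  destruct HK as [d [Hd H]]. exists d. split; [auto|].
  intros t Ht. apply robust_reg_le; auto; [lra|]. intros y Hy.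
  set (s := t / (r + t)). assert (Hs : s * (r + t) = t) by (unfold s; field; lra).
  assert (Hs0 : 0 <= s) by (apply Rlt_le, Rdiv_lt_0_compat; lra).
  assert (Hs1 : s <= 1) by (apply Rmult_le_reg_r with (r + t); lra).
  set (x := line xb y s).
  assert (Hx : dist x xb <= t).
  { unfold x. rewrite dist_line_0, (dist_sym xb) by auto.
    apply Rle_trans with (s * (r + t)); [apply Rmult_le_compat_l; auto|lra]. }
  assert (Hyx : dist y x <= r).
  { rewrite dist_sym. unfold x. rewrite dist_line_1, (dist_sym xb) by auto.
    apply Rle_trans with ((1 - s) * (r + t)); [apply Rmult_le_compat_l; lra|lra]. }
  pose proof (robust_reg_ub f hcont r x y Hyx).
  specialize (H x). pose proof (dist_pos x xb).
  assert (Rabs (G r x - g r) <= K * t).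
  { eapply Rle_trans; [apply H; lra|]. apply Rmult_le_compat_l; auto. }
  pose proof (Rle_abs (G r x - g r)). lra.
Qed.

(** * Calmness for small radii *)

(** Where calmness fails, [g] has infinite slope on the right or on the left. Tameness puts the same
    side on a whole interval, over which [g] would then have to grow by more than any finite
    amount. *)
Lemma eventually_calm : ev (fun r => exists K, calm_le r K).
Proof.
  destruct (ev_tame (fun r => exists K, calm_le r K)) as [H|H]; auto.
  { apply sa_ex, sa_calm_le; sa_tac. }
  exfalso. destruct H as [r0 [Hr0 H]].
  set (right r := forall K, ev (fun t => g r + K * t <= g (r + t))).
  set (left r := forall K, ev (fun t => g (r - t) + K * t <= g r)).
  assert (Hor : forall r, 0 < r < r0 -> right r \/ left r).
  { intros r Hr. apply NNPP. intros Hn. apply not_or_and in Hn as [Hn1 Hn2].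
    apply not_all_ex_not in Hn1 as [K1 H1]. apply not_all_ex_not in Hn2 as [K2 H2].
    (* The larger of the two constants violates both one-sided conditions at once. *)
    destruct (not_calm_le_slopes r (Rmax K1 K2) (proj1 Hr)) as [H3|H3].
    - intros HK. apply (H r Hr). now exists (Rmax K1 K2).
    - apply H1. revert H3. apply ev_imp. intros t Ht H3. pose proof (Rmax_l K1 K2). nra.
    - apply H2. revert H3. apply ev_imp. intros t Ht H3. pose proof (Rmax_r K1 K2). nra. }
  assert (Hs : sa (fun e => right (e O))).
  { unfold right. apply sa_all, sa_ev. sa_tac. }
  destruct (tame_interval right 0 r0 Hr0 Hs) as (a & b & H1 & H2 & H3).
  (* One more than the mean slope of [g] on the interval, so a growth at rate [K] is
     contradictory. *)
  set (K := (g b - g a) / (b - a) + 1).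
  assert (HK : K * (b - a) = g b - g a + (b - a)) by (unfold K; field; lra).
  assert (Hg : forall x y, a <= x -> x <= y -> y <= b -> g x <= g y).
  { intros x y Hx Hxy Hy. apply g_mono; lra. }
  assert (g a + K * (b - a) <= g b); [|lra].
  destruct H3 as [H3|H3].
  - apply (slope_lower (fun r => g r)); auto; [lra|]. intros r Hr. apply H3. lra.
  - apply (slope_lower_left (fun r => g r)); auto; [lra|]. intros r Hr.
    destruct (Hor r) as [H4|H4]; [lra| |apply H4]. exfalso. apply (H3 r); auto. lra.
Qed.

(** The equation [K * r = eta] is the polynomial form of [K = eta / r]. If this bound failed for all
    small [r], then [g] would have slope at least [eta / (2 * a)] between [a] and [2 * a], hence
    grow there by [eta / 2], while it lies between [f xb] and [f xb + eta / 4]. *)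
Lemma eventually_calm_small eta : 0 < eta ->
  ev (fun r => exists K, K * r = eta /\ calm_le r K).
Proof.
  intros Heta.
  assert (Hsa : sa (fun e => exists K, K * e O = eta /\ calm_le (e O) K)).
  { apply (sa_ex (fun e K => K * e O = eta /\ calm_le (e O) K)).
    apply sa_and; [|apply sa_calm_le]; sa_tac. }
  destruct (ev_tame (fun r => exists K, K * r = eta /\ calm_le r K) Hsa) as [H|H]; auto. exfalso.
  set (right r := exists K, K * r = eta /\ ev (fun t => g r + K * t <= g (r + t))).
  set (left r := exists K, K * r = eta /\ ev (fun t => g (r - t) + K * t <= g r)).
  assert (Hor : ev (fun r => right r \/ left r)).
  { revert H. apply ev_imp. intros r Hr H.
    assert (HK : eta / r * r = eta) by (field; lra).
    destruct (not_calm_le_slopes r (eta / r) Hr) as [H1|H1].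
    - intros H1. apply H. now exists (eta / r).
    - left. now exists (eta / r).
    - right. now exists (eta / r). }
  assert (Hs : sa (fun e => right (e O))).
  { unfold right. apply (sa_ex (fun e K => K * e O = eta /\
      ev (fun t => g (e O) + K * t <= g (e O + t)))).
    apply sa_and; [sa_tac|]. apply sa_ev. sa_tac. }
  assert (Hlim : ev (fun r => g r <= f xb + eta / 4)).
  { refine (ev_imp _ _ _ (robust_reg_at_0 f hcont xb (eta / 4) _)); [|lra].
    intros r _ Hr. lra. }
  assert (Hcases : ev right \/ ev left).
  { destruct (ev_tame right Hs) as [H1|H1]; [now left|right].
    refine (ev_imp _ _ _ (ev_and _ _ Hor H1)). tauto. }
  assert (Hgrow : exists a, 0 < a /\ g (2 * a) <= f xb + eta / 4 /\ g a + eta / 2 <= g (2 * a)).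
  { destruct Hcases as [H1|H1]; destruct (ev_and _ _ H1 Hlim) as [d [Hd HH]];
      exists (d / 3); (split; [lra|]); (split; [apply HH; lra|]);
      replace (eta / 2) with (eta / (2 * (d / 3)) * (2 * (d / 3) - d / 3)) by (field; lra).
    - apply (slope_lower (fun r => g r)); [lra|intros; apply g_mono; lra|].
      intros r Hr. destruct (HH r) as [[K [HK H2]] _]; [lra|].
      revert H2. apply ev_imp. intros t Ht H2.
      assert (eta / (2 * (d / 3)) <= K); [|nra].
      apply Rmult_le_reg_r with (2 * (d / 3)); [lra|].
      replace (eta / (2 * (d / 3)) * (2 * (d / 3))) with eta by (field; lra).
      assert (0 < K) by (apply Rmult_lt_reg_r with r; lra). nra.
    - apply (slope_lower_left (fun r => g r)); [lra|intros; apply g_mono; lra|].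
      intros r Hr. destruct (HH r) as [[K [HK H2]] _]; [lra|].
      revert H2. apply ev_imp. intros t Ht H2.
      assert (eta / (2 * (d / 3)) <= K); [|nra].
      apply Rmult_le_reg_r with (2 * (d / 3)); [lra|].
      replace (eta / (2 * (d / 3)) * (2 * (d / 3))) with eta by (field; lra).
      assert (0 < K) by (apply Rmult_lt_reg_r with r; lra). nra. }
  destruct Hgrow as (a & Ha & H1 & H2).
  assert (f xb <= g a); [|lra]. apply robust_reg_ub; auto. rewrite dist_refl. lra.
Qed.

(** * Steep points and the comparison of the two moduli *)

(** Slope in the radius at a fixed centre; by the basic inequality it dominates the variation of
    [G r] when the centre moves. *)
Definition steep (q r : R) (x : vec n) : Prop := ev (fun t => G r x + q * t <= G (r + t) x).

(** At a point that is not steep, tameness bounds the growth in the radius by [q] eventually, and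
    this bounds the growth of [G r] along any segment leaving that point. [slope_upper] integrates
    the bound over the segment from [x] to [y]. *)
Lemma lip_le_of_no_steep r q s : 0 < r -> 0 < s ->
  (forall x, dist x xb <= s -> ~ steep q r x) -> lip_le r q.
Proof.
  intros Hr Hs Hn.
  (* With endpoints within [s / 4] the segment is shorter than [s / 2], so all of it stays within
     [s] of [xb]. *)
  assert (H : forall x y, dist x xb < s / 4 -> dist y xb < s / 4 -> G r y <= G r x + q * dist x y).
  { intros x y Hx Hy. set (l := dist x y).
    assert (Hl : l < s / 2).
    { pose proof (dist_triangle x xb y). unfold l. rewrite (dist_sym xb y) in *. lra. }
    destruct (Rle_lt_or_eq_dec 0 l (dist_pos x y)) as [Hl0|Hl0].
    2:{ rewrite <- Hl0. assert (G r y <= G r x); [|lra]. apply robust_reg_mono; auto; [lra|].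
        rewrite dist_sym. fold l. lra. }
    rewrite <- (line_0 x y) at 1. rewrite <- (line_1 x y) at 1.
    replace (q * l) with (q * l * (1 - 0)) by ring.
    assert (Hscale : forall c, 0 < c -> 0 < c / l) by (intros; now apply Rdiv_lt_0_compat).
    assert (Hstep : forall c t, t < c / l -> t * l < c).
    { intros c t Ht. apply (Rmult_lt_compat_r l) in Ht; auto.
      replace (c / l * l) with c in Ht by (field; lra). exact Ht. }
    apply (slope_upper (fun t => G r (line x y t))); [lra| |].
    - intros t e Ht He. destruct (robust_reg_lsc f hcont r (line x y t) e Hr He) as [d [Hd H]].
      refine (ev_imp _ _ _ (ev_lt _ (Hscale d Hd))). intros u Hu Hud. apply H.
      rewrite dist_line. replace (t - u - t) with (- u) by ring.
      rewrite Rabs_Ropp, Rabs_pos_eq by lra. auto.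
    - intros t Ht. set (z := line x y t).
      assert (Hz : dist z xb <= s).
      { pose proof (dist_triangle z x xb) as H. unfold z in *. rewrite dist_line_0 in H by lra.
        fold l in H. assert (t * l <= 1 * l) by (apply Rmult_le_compat_r; lra). lra. }
      destruct (not_ev_tame (fun t => G r z + q * t <= G (r + t) z)) as [d [Hd H]].
      { sa_tac. }
      { exact (Hn z Hz). }
      refine (ev_imp _ _ _ (ev_lt _ (Hscale d Hd))). intros u Hu Hud.
      assert (0 < u * l) by now apply Rmult_lt_0_compat.
      specialize (H (u * l) (conj H0 (Hstep _ _ Hud))).
      assert (G r (line x y (t + u)) <= G (r + u * l) z); [|lra].
      apply robust_reg_mono; auto; [lra|]. unfold z. rewrite dist_line.
      replace (t + u - t) with u by ring. rewrite Rabs_pos_eq by lra. fold l. lra. }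
  exists (s / 4). split; [lra|]. intros x y Hx Hy.
  pose proof (H x y Hx Hy). pose proof (H y x Hy Hx) as H2. rewrite dist_sym in H2.
  apply Rabs_le. lra.
Qed.

(* Along a selection [x] of steep points that is Lipschitz with a small
   constant, the function [r |-> G r (x r)] has slopes close to [q2], although
   it stays close to [g], whose slopes are at most [q1]. *)
Lemma no_steep_family a b q1 q2 : 0 < a -> a < b -> 0 <= q1 -> q1 < q2 ->
  (forall r, a < r < b -> calm_le r q1) ->
  (forall r, a < r < b -> ~ lip_le r q2) -> False.
Proof.
  intros Ha Hab Hq1 Hq Hcalm Hlip.
  destruct (tame_pairs (fun x y => g y <= g x + q1 * (y - x)) a b Hab)
    as (a1 & b1 & H1 & H2 & Hg).
  { sa_tac. }
  { intros r Hr. refine (ev_imp _ _ _ (slope_of_calm_le r q1 _ (Hcalm r Hr))); [|lra].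
    intros t _ H. replace (r + t - r) with t by ring. exact H. }
  (* Chosen so that [q2 * (1 - th)] is the mean of [q1] and [q2]. *)
  set (th := (q2 - q1) / (2 * q2)).
  assert (Hth : th * q2 = (q2 - q1) / 2) by (unfold th; field; lra).
  assert (Hth0 : 0 < th) by (apply Rdiv_lt_0_compat; lra).
  assert (Hth1 : th < 1) by (apply Rmult_lt_reg_r with q2; lra).
  assert (Hn : 0 < INR n) by (apply lt_0_INR; lia).
  (* The selection is Lipschitz in each coordinate; dividing by [INR n] makes [th] the constant for
     the distance, through [dist_le_coords]. *)
  destruct (lipschitz_selection (fun r s x => dist x xb <= s /\ steep q2 r x) xb a1 b1 1
      (th / INR n)) as (d & a2 & b2 & Hd & H3 & H4 & Hsel).
  { intros u v X Hu Hv HX. apply sa_and; [sa_tac|]. apply sa_ev. sa_tac. }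
  { lra. } { lra. } { now apply Rdiv_lt_0_compat. }
  { intros r s Hr Hs. apply NNPP. intros Hne. apply (Hlip r); [lra|].
    apply lip_le_of_no_steep with s; [lra|lra|]. intros x Hx Hst. apply Hne. now exists x. }
  { intros r s x [Hx _] i Hi. apply Rle_trans with (dist x xb); auto using dist_coord. }
  (* The bound [m] makes the selection available at [s] and keeps [a2 - s] and [b2 + s] inside the
     interval where [Hg] holds. The second bound on [s] makes [q1 * (2 * s)] smaller than the excess
     growth; [q1 + 1] avoids dividing by 0. *)
  set (m := Rmin d (Rmin (a2 - a1) (b1 - b2))).
  set (s := Rmin m ((q2 - q1) * (b2 - a2) / (8 * (q1 + 1))) / 2).
  assert (Hm : 0 < m /\ m <= d /\ m <= a2 - a1 /\ m <= b1 - b2).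
  { unfold m. pose proof (Rmin_l d (Rmin (a2 - a1) (b1 - b2))).
    pose proof (Rmin_r d (Rmin (a2 - a1) (b1 - b2))).
    pose proof (Rmin_l (a2 - a1) (b1 - b2)). pose proof (Rmin_r (a2 - a1) (b1 - b2)).
    repeat split; try lra. repeat apply Rmin_glb_lt; lra. }
  assert (Hw : 0 < (q2 - q1) * (b2 - a2) / (8 * (q1 + 1))).
  { apply Rdiv_lt_0_compat; [apply Rmult_lt_0_compat|]; lra. }
  assert (Hs : 0 < s /\ s < m /\ s < (q2 - q1) * (b2 - a2) / (8 * (q1 + 1))).
  { unfold s. pose proof (Rmin_l m ((q2 - q1) * (b2 - a2) / (8 * (q1 + 1)))).
    pose proof (Rmin_r m ((q2 - q1) * (b2 - a2) / (8 * (q1 + 1)))).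
    assert (0 < Rmin m ((q2 - q1) * (b2 - a2) / (8 * (q1 + 1)))) by (apply Rmin_glb_lt; lra).
    lra. }
  assert (Hqs : q1 * (2 * s) < (q2 - q1) / 2 * (b2 - a2)).
  { destruct Hs as [Hs0 [_ Hs]]. apply (Rmult_lt_compat_r (8 * (q1 + 1))) in Hs; [|lra].
    replace ((q2 - q1) * (b2 - a2) / (8 * (q1 + 1)) * (8 * (q1 + 1)))
      with ((q2 - q1) * (b2 - a2)) in Hs by (field; lra).
    assert (0 < (q2 - q1) * (b2 - a2)) by (apply Rmult_lt_0_compat; lra). nra. }
  destruct (Hsel s) as (x & Hx1 & Hx2); [lra|].
  set (phi := fun r => G r (x r)).
  assert (Hdist : forall r1 r2, a2 <= r1 -> r1 < r2 -> r2 <= b2 ->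
      dist (x r1) (x r2) <= th * (r2 - r1)).
  { intros r1 r2 Hr1 Hr Hr2. rewrite dist_sym.
    replace (th * (r2 - r1)) with (INR n * (th / INR n * (r2 - r1))) by (field; lra).
    apply dist_le_coords. intros i Hi. auto. }
  assert (Hphi : phi a2 + q2 * (1 - th) * (b2 - a2) <= phi b2).
  { apply slope_lower; [lra| |].
    - intros u v Hu Huv Hv. destruct (Rle_lt_or_eq_dec u v Huv) as [H|<-]; [|lra].
      apply robust_reg_mono; auto; [lra|]. specialize (Hdist u v Hu H Hv). nra.
    - intros r Hr. destruct (Hx1 r) as [_ [e [He Hst]]]; [lra|].
      assert (Hbr : 0 < b2 - r) by lra.
      refine (ev_imp _ _ _ (ev_and _ _ (ev_lt e He) (ev_lt _ Hbr))).
      intros t Ht [Hte Htb].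
      assert (Htt : 0 < (1 - th) * t < e) by nra.
      specialize (Hst _ Htt). specialize (Hdist r (r + t) ltac:(lra) ltac:(lra) ltac:(lra)).
      (* Moving the centre from [x r] to [x (r + t)] uses up at most [th * t] of the radius; the
         remaining [(1 - th) * t] profits from steepness at [x r]. *)
      assert (G (r + (1 - th) * t) (x r) <= phi (r + t)); [|unfold phi in *; lra].
      apply robust_reg_mono; auto; lra. }
  assert (Hb2 : phi b2 <= g (b2 + s)).
  { apply robust_reg_mono; auto; [lra|]. destruct (Hx1 b2) as [H _]; lra. }
  assert (Ha2 : g (a2 - s) <= phi a2).
  { apply robust_reg_mono; auto; [lra|]. rewrite dist_sym. destruct (Hx1 a2) as [H _]; lra. }
  assert (Hgg : g (b2 + s) <= g (a2 - s) + q1 * (b2 + s - (a2 - s))) by (apply Hg; lra).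
  nra.
Qed.

(** [no_steep_family] needs two constants valid on a whole interval, whereas a failure gives
    constants depending on [r]. One covering makes the gap between them uniform, a second one makes
    the calmness bound uniform by rounding it to a grid. *)
Lemma eventually_lip_le_calm :
  ev (fun r => forall q1 q2, q1 < q2 -> calm_le r q1 -> lip_le r q2).
Proof.
  apply NNPP. intros Hn. apply not_ev_tame in Hn.
  2:{ apply (sa_all (fun e q1 => forall q2, q1 < q2 -> calm_le (e O) q1 -> lip_le (e O) q2)).
      apply (sa_all (fun e q2 => e O < q2 -> calm_le (e 1%nat) (e O) -> lip_le (e 1%nat) q2)).
      apply sa_imp; [sa_tac|]. apply sa_imp; [apply sa_calm_le|apply sa_lip_le]; sa_tac. }
  destruct Hn as [r0 [Hr0 Hn]].
  destruct (tame_cover (fun k r => exists q, calm_le r q /\ ~ lip_le r (q + / INR (S k))) 0 r0)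
    as (k & a & b & H1 & H2 & H3); auto.
  { intros k. apply (sa_ex (fun e q => calm_le (e O) q /\ ~ lip_le (e O) (q + / INR (S k)))).
    apply sa_and; [apply sa_calm_le|apply sa_not, sa_lip_le]; sa_tac. }
  { intros r Hr. specialize (Hn r Hr). apply NNPP. intros Hne. apply Hn.
    intros q1 q2 Hq Hc. apply NNPP. intros Hl.
    destruct (archimed_inv (q2 - q1)) as [k Hk]; [lra|].
    apply Hne. exists k, q1. split; auto. intros Hl'. apply Hl.
    apply lip_le_mono with (2 := Hl'). lra. }
  (* The mesh is a third of the gap: rounding [q] up to the grid and adding another [c] stays below
     [q + 3 * c], where the Lipschitz bound still fails. *)
  set (c := / INR (S k) / 3).
  assert (Hc : 0 < c).
  { unfold c. apply Rdiv_lt_0_compat; [|lra]. apply Rinv_0_lt_compat, lt_0_INR. lia. }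
  destruct (tame_cover (fun j r => calm_le r (INR j * c) /\ ~ lip_le r (INR j * c + c)) a b)
    as (j & a' & b' & H4 & H5 & H6); try lra.
  { intros j. apply sa_and; [apply sa_calm_le|apply sa_not, sa_lip_le]; sa_tac. }
  { intros r Hr. destruct (H3 r) as [q [Hq1 Hq2]]; [lra|].
    pose proof (calm_le_pos r q Hq1) as Hq.
    assert (Hqc : 0 <= q / c) by (apply Rmult_le_pos; [auto|apply Rlt_le, Rinv_0_lt_compat; auto]).
    destruct (archimed (q / c)) as [Hz1 Hz2].
    assert (Hz : (0 <= up (q / c))%Z) by (apply le_IZR; simpl; lra).
    exists (Z.to_nat (up (q / c))). rewrite INR_IZR_INZ, Z2Nat.id by auto.
    set (z := IZR (up (q / c))) in *.
    assert (Hq' : q / c * c = q) by (field; lra).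
    split.
    - apply calm_le_mono with (2 := Hq1). nra.
    - intros Hl. apply Hq2. apply lip_le_mono with (2 := Hl).
      assert (/ INR (S k) = 3 * c) by (unfold c; field; apply not_0_INR; lia). nra. }
  apply (no_steep_family a' b' (INR j * c) (INR j * c + c)); try lra.
  - apply Rmult_le_pos; [apply pos_INR|lra].
  - intros r Hr. apply H6. lra.
  - intros r Hr. apply H6. lra.
Qed.

(** The common value is the infimum of the calmness bounds, obtained as minus a supremum. The
    hypothesis gives the upper estimate for pairs, and the pairs with [x' = xb] give the lower
    one. *)
Lemma calm_lip_exists r :
  (exists K, calm_le r K) -> (forall q1 q2, q1 < q2 -> calm_le r q1 -> lip_le r q2) ->
  exists L, calm_is (G r) xb L /\ lip_is (G r) xb L.
Proof.
  intros [K0 HK0] Hlip.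
  destruct (completeness (fun k => calm_le r (- k))) as [m [Hm1 Hm2]].
  - exists 0. intros k Hk. apply calm_le_pos in Hk. lra.
  - exists (- K0). now rewrite Ropp_involutive.
  - assert (Hlow : forall e, e > 0 -> ~ calm_le r (- m - e)).
    { intros e He Hk. assert (m + e <= m); [|lra]. apply Hm1.
      now replace (- (m + e)) with (- m - e) by ring. }
    assert (Hup : forall e, e > 0 -> calm_le r (- m + e)).
    { intros e He. apply NNPP. intros Hk. assert (m <= m - e); [|lra].
      apply Hm2. intros k Hk'. apply Rnot_lt_le. intros Hlt. apply Hk.
      apply calm_le_mono with (2 := Hk'). lra. }
    assert (Hfar : forall e d, e > 0 -> d > 0 -> exists x, 0 < dist x xb < d /\
        Rabs (G r x - g r) / dist x xb > - m - e).
    { intros e d He Hd. apply NNPP. intros Hn. apply (Hlow e He). exists d. split; [auto|].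
      intros x Hx. destruct (Rle_lt_or_eq_dec 0 _ (dist_pos x xb)) as [H0|H0].
      - apply Rnot_lt_le. intros Hlt. apply Hn. exists x. split; [lra|].
        apply Rmult_gt_reg_l with (dist x xb); [lra|].
        replace (dist x xb * (Rabs (G r x - g r) / dist x xb)) with (Rabs (G r x - g r))
          by (field; lra). lra.
      (* At distance 0 the quotient says nothing; any calmness bound gives the required
         inequality. *)
      - destruct (Hup 1 Rlt_0_1) as [d' [Hd' H]]. specialize (H x). rewrite <- H0 in *. lra. }
    exists (- m). split; split.
    + intros e He. destruct (Hup (e / 2)) as [d [Hd H]]; [lra|].
      exists d. split; [auto|]. intros x Hx.
      apply Rle_lt_trans with (- m + e / 2); [|lra].
      apply Rmult_le_reg_r with (dist x xb); [lra|].
      replace (Rabs (G r x - g r) / dist x xb * dist x xb) with (Rabs (G r x - g r))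
        by (field; lra). apply H. lra.
    + exact Hfar.
    + intros e He. destruct (Hlip (- m + e / 3) (- m + e / 2)) as [d [Hd H]];
        [lra|apply Hup; lra|].
      exists d. split; [auto|]. intros x x' Hx Hx' Hxx'.
      apply Rle_lt_trans with (- m + e / 2); [|lra].
      apply Rmult_le_reg_r with (dist x x'); [lra|].
      replace (Rabs (G r x - G r x') / dist x x' * dist x x') with (Rabs (G r x - G r x'))
        by (field; lra). now apply H.
    + intros e d He Hd. destruct (Hfar e d He Hd) as [x [Hx1 Hx2]].
      exists x, xb. rewrite dist_refl. repeat split; lra.
Qed.

Lemma lip_is_bounds r L K : lip_is (G r) xb L -> lip_le r K -> 0 <= L <= K.
Proof.
  intros [HL1 HL2] [d [Hd H]]. split.
  - apply Rnot_lt_le. intros HL. destruct (HL1 (- L)) as [d' [Hd' H']]; [lra|].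
    destruct (exists_at_distance hn xb (d' / 2)) as [x Hx]; [lra|].
    assert (Hlt : Rabs (G r x - g r) / dist x xb < L + - L).
    { apply H'; rewrite ?dist_refl; lra. }
    assert (0 <= Rabs (G r x - g r) / dist x xb); [|lra].
    apply Rmult_le_pos; [apply Rabs_pos|]. apply Rlt_le, Rinv_0_lt_compat. lra.
  - apply Rnot_lt_le. intros HK.
    destruct (HL2 (L - K) d) as (x & x' & Hx & Hx' & Hxx' & Hgt); try lra.
    specialize (H x x' Hx Hx'). apply (Rmult_gt_compat_r (dist x x')) in Hgt; [|auto].
    replace (Rabs (G r x - G r x') / dist x x' * dist x x') with (Rabs (G r x - G r x'))
      in Hgt by (field; lra).
    replace (L - (L - K)) with K in Hgt by ring. lra.
Qed.

End Moduli.

Theorem theorem5p3 (n : nat) (hn : (1 <= n)%nat) (f : vec n -> R)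
  (hcont : continuous_vec f) (hsa : semialgebraic_fun f) (xb : vec n) :
  exists epsb, epsb > 0 /\
    (forall eps, 0 < eps <= epsb ->
       exists L, calm_is (robust_reg f eps) xb L /\ lip_is (robust_reg f eps) xb L) /\
    (forall eta, eta > 0 -> exists delta, delta > 0 /\
       forall eps L, 0 < eps < delta -> eps <= epsb ->
         lip_is (robust_reg f eps) xb L -> Rabs (eps * L) < eta).
Proof.
  pose proof (eventually_lip_le_calm hn f hcont hsa xb) as Hlip.
  destruct (ev_and _ _ (eventually_calm f hcont hsa xb) Hlip) as [d [Hd H]].
  (* [H] holds for radii strictly below [d], while [epsb] itself must be allowed. *)
  exists (d / 2). split; [lra|]. split.
  - intros eps Heps. destruct (H eps) as [H1 H2]; [lra|]. now apply calm_lip_exists.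
  - intros eta Heta. assert (Heta' : 0 < eta / 2) by lra.
    destruct (ev_and _ _ Hlip (eventually_calm_small f hcont hsa xb _ Heta'))
      as [d' [Hd' H']].
    exists d'. split; [auto|]. intros eps L Heps _ HL.
    destruct (H' eps Heps) as [H1 [K [HK1 HK2]]].
    (* Passing from calmness to a Lipschitz bound needs a strictly larger constant. After
       multiplication by [eps] the total is [eta / 2 + eta / 4], still below [eta]. *)
    assert (Hl : lip_le f xb eps (K + eta / (4 * eps))).
    { apply (H1 K); auto. assert (0 < eta / (4 * eps)) by (apply Rdiv_lt_0_compat; lra). lra. }
    destruct (lip_is_bounds hn f xb eps L _ HL Hl) as [H2 H3].
    assert (eps * L <= eps * (K + eta / (4 * eps))) by (apply Rmult_le_compat_l; lra).
    replace (eps * (K + eta / (4 * eps))) with (K * eps + eta / 4) in * by (field; lra).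
    rewrite Rabs_pos_eq by (apply Rmult_le_pos; lra). lra.
Qed.
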